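(* Let $\mathcal P_t=e^{t\mathcal L}$ be a primitive quantum Markov semigroup satisfying the $\sigma$-GNS detailed balance condition for its full-rank invariant state $\sigma$. Let $p\in(1,2]$ and $q=2/p\in[1,2)$. If the dual $q$-Beckner inequality $(\mathrm{Bec}'_q)$ holds with constant $\beta_q$, then the $p$-Beckner inequality $(\mathrm{Bec}_p)$ holds with a constant $\alpha_p\ge\beta_q/2$.
   Context: $\mathcal H$ is a finite-dimensional Hilbert space, $\mathcal B(\mathcal H)$ the operators on it. A quantum Markov semigroup (QMS) is a $C_0$-semigroup $(\mathcal P_t)_{t\ge0}$ of completely positive unital maps on $\mathcal B(\mathcal H)$, with generator $\mathcal L$; $\dagger$ is the adjoint for the Hilbert–Schmidt inner product. It is primitive if it has a unique invariant state $\sigma$ ($\mathcal P_t^\dagger(\sigma)=\sigma$ for all $t$) and $\sigma$ has full rank. The $\sigma$-GNS detailed balance condition means that $\mathcal L$ is self-adjoint for $\langle X,Y\rangle_{\sigma,1}=\mathrm{Tr}(\sigma X^*Y)$. Put $\langle X,Y\rangle_{\sigma,1/2}=\mathrm{Tr}(\sigma^{1/2}X^*\sigma^{1/2}Y)$. Let $\Gamma_\sigma^{s}(X)=\sigma^{s/2}X\sigma^{s/2}$, $\|X\|_{p,\sigma}=\mathrm{Tr}\big(|\Gamma_\sigma^{1/p}(X)|^p\big)^{1/p}$ for $p>0$, and $\hat p=p/(p-1)$. For $p>1$ and $X>0$, $$\mathcal E_{p,\mathcal L}(X)=-\frac{\hat p\,p}{4}\Big\langle \Gamma_\sigma^{-1/\hat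 p}\big((\Gamma_\sigma^{1/p}(X))^{p-1}\big),\mathcal L(X)\Big\rangle_{\sigma,1/2},$$ and $\mathcal E_{2,\mathcal L}(Y)=-\langle Y,\mathcal L(Y)\rangle_{\sigma,1/2}$ for $Y\ge0$. $(\mathrm{Bec}_p)$ with constant $\alpha_p>0$: $\alpha_p\,\hat p\,(\|X\|_{p,\sigma}^p-\|X\|_{1,\sigma}^p)\le\mathcal E_{p,\mathcal L}(X)$ for all $X>0$. $(\mathrm{Bec}'_q)$ with constant $\beta_q>0$, $q\in(0,2)$: $\beta_q\,(\|Y\|_{2,\sigma}^2-\|Y\|_{q,\sigma}^2)\le(2-q)\,\mathcal E_{2,\mathcal L}(Y)$ for all $Y\ge0$. *)

(* Defs.v *)
From HB Require Import structures.
From mathcomp Require Import all_boot all_order all_algebra.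
From mathcomp Require Import sesquilinear spectral complex.
From mathcomp Require mxtens.
From mathcomp Require Import all_classical all_reals all_analysis.

Set Implicit Arguments.
Unset Strict Implicit.
Unset Printing Implicit Defensive.

Import Order.TTheory GRing.Theory Num.Theory numFieldNormedType.Exports.
Local Open Scope ring_scope.
Local Open Scope complex_scope.
Local Open Scope sesquilinear_scope.

(* The Hilbert space is C^n, with C = R[i] for R : realType; the operators on
   it are the n x n complex matrices acting on column vectors, and A ^t* is the
   adjoint of A. On R[i] the order x <= y means that y - x is real and
   nonnegative. *)

Section Operators.
Variables (R : realType) (n : nat).
Local Notation C := R[i].
Local Notation M := 'M[C]_n.

Definition psdmx m (A : 'M[C]_m) : Prop :=
  forall v : 'cV[C]_m, 0 <= (v ^t* *m A *m v) 0 0.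

Definition pdmx (A : M) : Prop :=
  forall v : 'cV[C]_n, v != 0 -> 0 < (v ^t* *m A *m v) 0 0.

(* Functional calculus, meaningful for self-adjoint A: its spectrum is then
   real, and f acts on the eigenvalues. *)
Definition mxfun (f : R -> R) (A : M) : M :=
  invmx (spectralmx A)
    *m diag_mx (map_mx (fun z : C => (f (complex.Re z))%:C) (spectral_diag A))
    *m spectralmx A.

(* A ^ s for A psd (for A > 0 if s < 0) *)
Definition mxpowR (A : M) (s : R) : M := mxfun (fun x => x `^ s) A.

Definition mxabs (X : M) : M := mxpowR (X ^t* *m X) 2^-1.

Definition hs (X Y : M) : C := \tr (X ^t* *m Y).

Definition hs_adj (F : M -> M) (Y : M) : M :=
  \matrix_(i, j) hs (F (delta_mx i j)) Y.

Lemma hs_adjP (F : {linear M -> M}) (X Y : M) :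
  hs X (hs_adj F Y) = hs (F X) Y.
Proof.
have hsE (A B : M) : hs A B = \sum_i \sum_j (A i j)^* * B i j.
  rewrite /hs /mxtrace exchange_big /=; apply: eq_bigr => j _.
  by rewrite mxE; apply: eq_bigr => i _; rewrite !mxE.
have hsDl B : {morph hs^~ B : A A' / A + A'}.
  by move=> A A'; rewrite /hs linearD /= map_mxD mulmxDl linearD.
have hs0l B : hs 0 B = 0 by rewrite /hs trmx0 map_mx0 mul0mx linear0.
have hsZl c A B : hs (c *: A) B = c^* * hs A B.
  by rewrite /hs linearZ /= map_mxZ -scalemxAl linearZ.
rewrite hsE {2}(matrix_sum_delta X) linear_sum (big_morph _ (hsDl Y) (hs0l Y)).
apply: eq_bigr => i _; rewrite linear_sum (big_morph _ (hsDl Y) (hs0l Y)).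
by apply: eq_bigr => j _; rewrite linearZ hsZl mxE.
Qed.

(* id_k (x) F acting on M_k (x) M_n, identified with the (k * n) x (k * n)
   matrices through the index bijection of the Kronecker product. *)
Definition ampliation (k : nat) (F : M -> M) (X : 'M[C]_(k * n)) :
    'M[C]_(k * n) :=
  \matrix_(u, v)
    let: (a, i) := mxtens.mxtens_unindex u in
    let: (b, j) := mxtens.mxtens_unindex v in
    F (\matrix_(i', j') X (mxtens.mxtens_index (a, i'))
                          (mxtens.mxtens_index (b, j'))) i j.

Lemma ampliation_tens (k : nat) (F : {linear M -> M}) (A : 'M[C]_k) (B : M) :
  ampliation F (mxtens.tensmx A B) = mxtens.tensmx A (F B).
Proof.
apply/matrixP => u v; rewrite !mxE.
case: (mxtens.mxtens_unindex u) => a i; case: (mxtens.mxtens_unindex v) => b j.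
rewrite /= (_ : \matrix_(_, _) _ = A a b *: B); first by rewrite linearZ mxE.
by apply/matrixP => i' j'; rewrite mxE mxtens.tensmxE mxE.
Qed.

Definition completely_positive (F : M -> M) : Prop :=
  forall (k : nat) (X : 'M[C]_(k * n)), psdmx X -> psdmx (ampliation F X).

(* F(t) --> A as t -> 0+. The topology of C is carried by C^o. *)
Definition mx_cvg0 (F : R -> M) (A : M) : Prop :=
  ((F : R -> 'M[C^o]_n) t @[t --> 0^'+] --> (A : 'M[C^o]_n))%classic.

(* Only the values of P at t >= 0 matter. *)
Definition QMS (P : R -> {linear M -> M}) : Prop :=
  [/\ forall t, 0 <= t -> completely_positive (P t),
      forall t, 0 <= t -> P t 1%:M = 1%:M,
      forall X, P 0 X = X,
      forall s t X, 0 <= s -> 0 <= t -> P (s + t) X = P s (P t X)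
    & forall X, mx_cvg0 (fun t => P t X) X].

Definition is_generator (P : R -> {linear M -> M}) (L : {linear M -> M}) :
    Prop :=
  forall X, mx_cvg0 (fun t => (t^-1)%:C *: (P t X - X)) (L X).

Definition is_state (rho : M) : Prop := psdmx rho /\ \tr rho = 1.

Definition invariant_state (P : R -> {linear M -> M}) (rho : M) : Prop :=
  is_state rho /\ forall t, 0 <= t -> hs_adj (P t) rho = rho.

Definition primitive_with (P : R -> {linear M -> M}) (sigma : M) : Prop :=
  [/\ invariant_state P sigma,
      forall rho, invariant_state P rho -> rho = sigma
    & \rank sigma = n].

Definition ip_one (sigma X Y : M) : C := \tr (sigma *m X ^t* *m Y).

Definition ip_half (sigma X Y : M) : C :=
  \tr (mxpowR sigma 2^-1 *m X ^t* *m mxpowR sigma 2^-1 *m Y).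

Definition GNS_detailed_balance (sigma : M) (L : {linear M -> M}) : Prop :=
  forall X Y, ip_one sigma (L X) Y = ip_one sigma X (L Y).

Definition Gam (sigma : M) (s : R) (X : M) : M :=
  mxpowR sigma (s / 2) *m X *m mxpowR sigma (s / 2).

(* The trace below is real and nonnegative. *)
Definition wnorm (sigma : M) (p : R) (X : M) : R :=
  (complex.Re (\tr (mxpowR (mxabs (Gam sigma p^-1 X)) p))) `^ p^-1.

Definition conj_exp (p : R) : R := p / (p - 1).

Definition dirichlet (p : R) (sigma : M) (L : {linear M -> M}) (X : M) : C :=
  - (conj_exp p * p / 4)%:C *
    ip_half sigma
      (Gam sigma (- (conj_exp p)^-1) (mxpowR (Gam sigma p^-1 X) (p - 1)))
      (L X).

Definition dirichlet2 (sigma : M) (L : {linear M -> M}) (Y : M) : C :=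
  - ip_half sigma Y (L Y).

Definition Beckner (p : R) (sigma : M) (L : {linear M -> M}) (alpha : R) :
    Prop :=
  0 < alpha /\
  forall X, pdmx X ->
    (alpha * conj_exp p *
       (wnorm sigma p X `^ p - wnorm sigma 1 X `^ p))%:C
    <= dirichlet p sigma L X.

Definition dual_Beckner (q : R) (sigma : M) (L : {linear M -> M}) (beta : R) :
    Prop :=
  0 < beta /\
  forall Y, psdmx Y ->
    (beta * (wnorm sigma 2 Y ^+ 2 - wnorm sigma q Y ^+ 2))%:C
    <= (2 - q)%:C * dirichlet2 sigma L Y.

End Operators.

(* Main.v *)
Require Import Defs.
From HB Require Import structures.
From mathcomp Require Import all_boot all_order all_algebra.
From mathcomp Require Import sesquilinear spectral complex.
From mathcomp Require mxtens.
From mathcomp Require Import ring lra.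
From mathcomp Require Import all_classical all_reals all_analysis.
From mathcomp Require Import measurable_realfun.

(** Put A = Gam sigma (1/p) X > 0 and let Y = Gam sigma (-1/2) (A ^ (p/2)), so
    that |Y|_2 ^ 2 = Tr (A ^ p) = |X|_p ^ p. The p-Beckner inequality for X is
    the dual q-Beckner inequality for Y, up to the two comparisons
        |Y|_q ^ 2 <= |X|_1 ^ p    and    E_2 (Y) <= E_p (X),
    because (conj_exp p / 2) (2 - q) = 1 when q = 2 / p; hence alpha = beta / 2.

    The energy comparison is a Stroock-Varopoulos inequality. In an eigenbasis
    u_i of sigma, with eigenvalues s_i, the generator has the coefficients
        ell i j a b = <u_i, L (|u_a><u_b|) u_j>.
    GNS-symmetry gives s_i ell i j a b = s_a ell b a j i, and, by hermiticity,
    s_j ell i j a b = s_b ell b a j i; so ell i j a b vanishes unless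
    s_i / s_a = s_j / s_b, and exchanging (i, a) with (b, j) costs the factor
    r = s_i / s_a. This is what commutation with the modular group of sigma
    amounts to. Let a_k be the eigenvalues of A. Both energies are then sums
    of x ^ al * y ^ be against the same complex weights, where x = a_k and
    y = a_l r ^ (1/p); the exchange symmetry swaps x and y, and L 1 = 0 kills
    the sums of x ^ p and y ^ p. After symmetrisation, 2 (E_p - E_2) is the sum
    of the scalar function
        H = p^2 / (4 (p - 1)) (x - y) (x ^ (p-1) - y ^ (p-1))
              - (x ^ (p/2) - y ^ (p/2)) ^ 2,
    which is nonnegative ([stroock_varopoulos_scalar]). Since H depends on
    (i, a) only through r, it can be written as the product of its square roots
    at (i, a) and at (j, b), and the sum becomes a sum of values of the Choi
    form of L. Being a derivative at 0 of completely positive maps, L has a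
    Choi form that is nonnegative on traceless arguments, and H = 0 at x = y
    ensures tracelessness ([generator_choi_form_ge0], [kernel_sum_ge0],
    [stroock_varopoulos]).

    The norm comparison is the Lieb-Thirring inequality
        Tr (B C B) ^ q <= Tr (B ^ q C ^ q B ^ q)
    for q >= 1, B a power of sigma and C = A ^ (p/2). To prove it, s ^ (1-tau)
    z ^ tau is written as an integral over l > 0 of the parallel sums
    (l s) z / (l s + z), which satisfy
        (l s) z / (l s + z) |u + v|^2 <= l s |u|^2 + z |v|^2.
    With s, z ranging over the eigenvalues of C ^ q and (B C B) ^ q, and with B
    split into the two functions rho / (l + rho) B and l / (l + rho) B,
    rho = B ^ (2 q), both sides sum to traces. By homogeneity the integrals
    give (K1 + K2) Tr (B C B) ^ q <= K1 Tr (B ^ q C ^ q B ^ q)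
    + K2 Tr (B C B) ^ q with K1 > 0, which is the claim
    ([power_mean_le], [lieb_thirring]). *)

Set Implicit Arguments.
Unset Strict Implicit.
Unset Printing Implicit Defensive.

Import Order.TTheory GRing.Theory Num.Theory numFieldNormedType.Exports.
Local Open Scope ring_scope.
Local Open Scope sesquilinear_scope.

(** * Scale-invariant integrals and the powers they represent *)

Section LogKernel.
Context {R : realType}.
Local Notation mu := (@lebesgue_measure R).
Implicit Types (G : R -> R) (tau x y : R).
Local Open Scope classical_set_scope.
Local Open Scope ereal_scope.

Lemma integral_translate G y : continuous G -> (forall x, 0 <= G x)%R ->
  \int[mu]_x (G (x - y)%R)%:E = \int[mu]_x (G x)%:E.
Proof.
move=> cG G0; pose F := (fun x : R => x - y)%R.
have dF x : is_derive x (1%R : R) F 1%R.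
  by rewrite /F; apply: is_derive_eq; rewrite oppr0 addr0.
have F1 : F^`()%classic = cst 1%R.
  by apply/funext => x; rewrite derive1E; apply: derive_val.
rewrite [RHS](@increasing_ge0_integration_by_substitutionT R F G) //.
- by apply: eq_integral => x _; rewrite fctE F1 /= mulr1.
- by move=> a b ab; rewrite /F ltrD2r.
- by rewrite F1; exact: cst_continuous.
- by rewrite F1; apply: is_cvg_cst.
- by rewrite F1; apply: is_cvg_cst.
- by rewrite /F; apply: cvg_addrr_Ny.
- by rewrite /F; apply: cvg_addrr.
Qed.

(** The substitution l = expR x turns the integral of l ^ (c-1) / (l + 1) ^ k
    over l > 0 into that of [logkernel c k], and the scalings of l into
    translations of x. *)
Definition logkernel (c : R) (k : nat) x : R := (expR (c * x) / (expR x + 1) ^+ k)%R.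

Lemma logkernel_ge0 c k x : (0 <= logkernel c k x)%R.
Proof. by rewrite divr_ge0 ?expR_ge0 ?exprn_ge0 ?addr_ge0 ?expR_ge0. Qed.

Lemma continuous_logkernel c k : continuous (logkernel c k).
Proof.
move=> x; apply: cvgM.
  apply: continuous_comp; last exact: continuous_expR.
  by apply: cvgM; [exact: cvg_cst | exact: cvg_id].
apply: cvgV.
  by rewrite expf_neq0 // gt_eqF // addr_gt0 // expR_gt0.
apply: (@continuous_comp _ _ _ (fun x => expR x + 1)%R (fun z => z ^+ k)%R).
  by apply: cvgD; [exact: continuous_expR | exact: cvg_cst].
exact: exprn_continuous.
Qed.

Lemma measurable_logkernel c k y :
  measurable_fun setT (fun x : R => (logkernel c k (x - y)%R)%:E).
Proof.
apply/measurable_EFinP; apply: continuous_measurable_fun => x.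
apply: (@continuous_comp _ _ _ (fun x => x - y)%R (logkernel c k)).
  by apply: cvgB; [exact: cvg_id | exact: cvg_cst].
exact: continuous_logkernel.
Qed.

(** The kernel decays like expR (c x) at -oo and like expR (- (1 - c) x) at
    +oo; both bounds are multiples of exponential densities. *)
Lemma integral_logkernel_lty c : (0 < c < 1)%R ->
  \int[mu]_x (logkernel c 1 x)%:E < +oo.
Proof.
move=> /andP[c0 c1]; have d0 : (0 < 1 - c)%R by rewrite subr_gt0.
pose e1 x := (exponential_pdf (1 - c) x)%:E.
pose e2 x := (exponential_pdf c x)%:E.
have m1 : measurable_fun setT e1.
  by apply/measurable_EFinP; exact: measurable_exponential_pdf.
have m2 : measurable_fun setT e2.
  by apply/measurable_EFinP; exact: measurable_exponential_pdf.
have e10 x : 0 <= e1 x by rewrite lee_fin exponential_pdf_ge0 // ltW.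
have e20 x : 0 <= e2 x by rewrite lee_fin exponential_pdf_ge0 // ltW.
have mN : measurable_fun [set: R] (-%R : R -> R) by exact: measurable_funN.
have m2N : measurable_fun setT (e2 \o -%R) by exact: measurableT_comp.
have i2N : \int[mu]_x (e2 (- x)%R) = 1.
  rewrite -[RHS](integral_exponential_pdf c0).
  transitivity (\int[pushforward mu (-%R : _ -> measurableTypeR R)]_x e2 x).
    by rewrite ge0_integral_pushforward.
  by apply: eq_measure_integral => A mA _; exact: lebesgue_measureN.
have le12 x : (logkernel c 1 x)%:E <=
    ((1 - c)^-1)%:E * e1 x + (c^-1)%:E * e2 (- x)%R.
  rewrite /e1 /e2 /logkernel expr1 -!EFinM -EFinD lee_fin.
  have ex := expR_gt0 x.
  have [x0|x0] := leP 0%R x.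
    rewrite exponential_pdfE // mulrA mulVf ?gt_eqF // mul1r.
    apply: le_trans (_ : _ <= expR (- (1 - c) * x))%R _; last first.
      by rewrite lerDl mulr_ge0 ?invr_ge0 ?exponential_pdf_ge0 ?ltW.
    rewrite ler_pdivrMr ?addr_gt0 // (_ : (c * x = - (1 - c) * x + x)%R); last by ring.
    by rewrite expRD ler_wpM2l ?expR_ge0 // lerDl.
  rewrite (@exponential_pdfE _ c) ?oppr_ge0 ?(ltW x0) // [(c^-1 * _)%R]mulrA mulVf ?gt_eqF // mul1r.
  apply: le_trans (_ : _ <= expR (- c * - x))%R _; last first.
    by rewrite lerDr mulr_ge0 ?invr_ge0 ?exponential_pdf_ge0 ?ltW.
  by rewrite mulrNN ler_pdivrMr ?addr_gt0 // ler_peMr ?expR_ge0 // lerDr ltW.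
have mk : measurable_fun setT (fun x => (logkernel c 1 x)%:E).
  by have := measurable_logkernel c 1 0; under eq_fun do rewrite subr0.
apply: le_lt_trans (_ : _ <= ((1 - c)^-1)%:E * 1 + (c^-1)%:E * 1) _; last first.
  by rewrite !mule1 -EFinD ltry.
have p1 x : 0 <= ((1 - c)^-1)%:E * e1 x by rewrite mule_ge0 // lee_fin invr_ge0 ltW.
have p2 x : 0 <= (c^-1)%:E * e2 (- x)%R by rewrite mule_ge0 // lee_fin invr_ge0 ltW.
have -> : ((1 - c)^-1)%:E * 1 + (c^-1)%:E * 1 =
    \int[mu]_x (((1 - c)^-1)%:E * e1 x + (c^-1)%:E * e2 (- x)%R).
  rewrite ge0_integralD //=; [|exact: measurable_funeM..].
  rewrite !ge0_integralZl_EFin ?invr_ge0 ?(ltW c0) ?(ltW d0) //=.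
  by rewrite i2N (integral_exponential_pdf d0).
apply: ge0_le_integral => //=.
- by move=> x _; rewrite lee_fin logkernel_ge0.
- by apply: emeasurable_funD; exact: measurable_funeM.
Qed.

Lemma integral_logkernel_gt0 c k : (0 < c)%R ->
  0 < \int[mu]_x (logkernel c k x)%:E.
Proof.
move=> c0; have e0 : (0 < expR 1 + 1 :> R)%R by rewrite addr_gt0 ?expR_gt0.
pose m := ((expR 1 + 1) ^- k : R)%R.
have mk : measurable_fun setT (fun x => (logkernel c k x)%:E).
  by have := measurable_logkernel c k 0; under eq_fun do rewrite subr0.
apply: lt_le_trans (_ : 0 < \int[mu]_(x in `[0%R, 1%R]) m%:E) _.
  rewrite integral_cst //= lebesgue_measure_itv /= lte_fin ltr01 oppr0 adde0 mule1.
  by rewrite lte_fin invr_gt0 exprn_gt0.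
apply: le_trans (_ : _ <= \int[mu]_(x in `[0%R, 1%R]) (logkernel c k x)%:E) _.
  apply: ge0_le_integral => //=.
  - by move=> x _; rewrite lee_fin invr_ge0 exprn_ge0 ?ltW.
  - exact: measurable_funTS mk.
  move=> x; rewrite in_itv /= => /andP[x0 x1]; rewrite lee_fin /logkernel.
  have ex : (0 < expR x + 1)%R by rewrite addr_gt0 ?expR_gt0.
  rewrite -[leLHS]mul1r; apply: ler_pM => //.
  - by rewrite invr_ge0 exprn_ge0 // ltW.
  - by rewrite -expR0 ler_expR mulr_ge0 // ltW.
  - rewrite lef_pV2 ?posrE ?exprn_gt0 // lerXn2r ?nnegrE ?(ltW ex) ?(ltW e0) //.
    by rewrite lerD2r ler_expR.
apply: ge0_subset_integral => //= x _.
by rewrite lee_fin logkernel_ge0.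
Qed.

End LogKernel.

Section PowerRepresentation.
Context {R : realType}.
Local Notation mu := (@lebesgue_measure R).
Local Open Scope classical_set_scope.
Local Open Scope ereal_scope.

Lemma integral_sum_logkernel (I : finType) (w y : I -> R) (c K : R) k :
  (forall i, 0 <= w i)%R -> \int[mu]_x (logkernel c k x)%:E = K%:E ->
  \int[mu]_x (\sum_i w i * logkernel c k (x - y i))%:E = (K * \sum_i w i)%:E.
Proof.
move=> w0 IK; under eq_integral do rewrite -sumEFin.
rewrite ge0_integral_sum //=; last 2 first.
- move=> i; under eq_fun do rewrite EFinM.
  by apply: measurable_funeM; exact: measurable_logkernel.
- by move=> i x _; rewrite lee_fin mulr_ge0 ?logkernel_ge0.
rewrite mulr_sumr -sumEFin; apply: eq_bigr => i _.
under eq_integral do rewrite EFinM.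
rewrite ge0_integralZl_EFin //=.
- rewrite (integral_translate (y i) (@continuous_logkernel R c k) (@logkernel_ge0 R c k)).
  by rewrite IK -EFinM mulrC.
- by move=> x _; rewrite lee_fin logkernel_ge0.
- exact: measurable_logkernel.
Qed.

Lemma measurable_sum_logkernel (I : finType) (w y : I -> R) (c : R) k :
  measurable_fun setT (fun x : R => (\sum_i w i * logkernel c k (x - y i))%:E).
Proof.
under eq_fun do rewrite -sumEFin.
apply: emeasurable_sum => i.
under eq_fun do rewrite EFinM.
by apply: measurable_funeM; exact: measurable_logkernel.
Qed.

Local Open Scope ring_scope.

(** By scaling l, the integrals over l > 0 of l ^ (tau-2) times
    l t / (l + t), l (rho / (l + rho)) ^ 2 and (l / (l + rho)) ^ 2 are
    proportional to t ^ tau, rho ^ tau and rho ^ (tau-1). The three factors are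
    K1 + K2, K1 and K2, since at t = rho = 1 the last two integrands add up to
    the first. An inequality between the integrands, valid for every l, thus
    becomes an inequality between powers. *)
Lemma power_mean_le (tau : R) : 0 < tau < 1 -> exists K1 K2 : R, 0 < K1 /\
  forall (J I I' : finType) (al t : J -> R) (be rho : I -> R) (ga rho' : I' -> R),
  (forall j, 0 <= al j) -> (forall j, 0 < t j) ->
  (forall i, 0 <= be i) -> (forall i, 0 < rho i) ->
  (forall i, 0 <= ga i) -> (forall i, 0 < rho' i) ->
  (forall l, 0 < l ->
     \sum_j al j * (l * t j / (l + t j)) <=
     \sum_i be i * (l * (rho i / (l + rho i)) ^+ 2) +
     \sum_i ga i * (l / (l + rho' i)) ^+ 2) ->
  (K1 + K2) * \sum_j al j * t j `^ tau <=
  K1 * \sum_i be i * rho i `^ tau + K2 * \sum_i ga i * rho' i `^ (tau - 1).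
Proof.
move=> /andP[t0 t1].
have m0 : measurable_fun setT (fun x : R => (logkernel tau 1 x)%:E).
  by have := measurable_logkernel tau 1 0; under eq_fun do rewrite subr0.
have m1 : measurable_fun setT (fun x : R => (logkernel tau 2 x)%:E).
  by have := measurable_logkernel tau 2 0; under eq_fun do rewrite subr0.
have m2 : measurable_fun setT (fun x : R => (logkernel (tau + 1) 2 x)%:E).
  by have := measurable_logkernel (tau + 1) 2 0; under eq_fun do rewrite subr0.
have kD (x : R) : logkernel tau 1 x = logkernel tau 2 x + logkernel (tau + 1) 2 x.
  rewrite /logkernel mulrDl mul1r expRD; field.
  by rewrite gt_eqF // addr_gt0 ?expR_gt0.
have KD : (\int[mu]_x (logkernel tau 1 x)%:E = \int[mu]_x (logkernel tau 2 x)%:E +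
    \int[mu]_x (logkernel (tau + 1) 2 x)%:E)%E.
  rewrite -ge0_integralD //=; last 2 first.
  - by move=> x _; rewrite lee_fin logkernel_ge0.
  - by move=> x _; rewrite lee_fin logkernel_ge0.
  by apply: eq_integral => x _; rewrite kD.
have t01 : 0 < tau < 1 by rewrite t0.
have := integral_logkernel_lty t01; rewrite KD => lty.
have ge1 : (0 <= \int[mu]_x (logkernel tau 2 x)%:E)%E.
  by apply: integral_ge0 => x _; rewrite lee_fin logkernel_ge0.
have ge2 : (0 <= \int[mu]_x (logkernel (tau + 1) 2 x)%:E)%E.
  by apply: integral_ge0 => x _; rewrite lee_fin logkernel_ge0.
have gt1 := integral_logkernel_gt0 2 t0.
move: lty ge1 ge2 gt1 KD.
case E1 : (\int[mu]_x (logkernel tau 2 x)%:E)%E => [K1| |] //;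
case E2 : (\int[mu]_x (logkernel (tau + 1) 2 x)%:E)%E => [K2| |] // _ _ _.
rewrite lte_fin => K1_gt0 /= E0.
exists K1, K2; split=> // J I I' al t be rho ga rho' al0 t_gt0 be0 rho0 ga0 rho'0 H.
have powE (a s : R) : 0 < a -> a `^ s = expR (s * ln a).
  by move=> a0; rewrite /powR gt_eqF.
(* The two sides of the hypothesis at l = expR x, times l ^ (tau-1). *)
pose f0 (x : R) := \sum_j (al j * t j `^ tau) * logkernel tau 1 (x - ln (t j)).
pose f1 (x : R) := \sum_i (be i * rho i `^ tau) * logkernel tau 2 (x - ln (rho i)).
pose f2 (x : R) := \sum_i (ga i * rho' i `^ (tau - 1)) *
                      logkernel (tau + 1) 2 (x - ln (rho' i)).
have f0E : (\int[mu]_x (f0 x)%:E)%E = ((K1 + K2) * \sum_j al j * t j `^ tau)%:E.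
  by apply: integral_sum_logkernel => // j; rewrite mulr_ge0 ?powR_ge0.
have f1E : (\int[mu]_x (f1 x)%:E)%E = (K1 * \sum_j be j * rho j `^ tau)%:E.
  by apply: integral_sum_logkernel => // j; rewrite mulr_ge0 ?powR_ge0.
have f2E : (\int[mu]_x (f2 x)%:E)%E = (K2 * \sum_j ga j * rho' j `^ (tau - 1))%:E.
  by apply: integral_sum_logkernel => // j; rewrite mulr_ge0 ?powR_ge0.
have f1_ge0 x : 0 <= f1 x.
  by apply: sumr_ge0 => i _; rewrite !mulr_ge0 ?powR_ge0 ?logkernel_ge0.
have f2_ge0 x : 0 <= f2 x.
  by apply: sumr_ge0 => i _; rewrite !mulr_ge0 ?powR_ge0 ?logkernel_ge0.
rewrite -lee_fin EFinD -f0E -f1E -f2E -ge0_integralD //=; last 4 first.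
- by move=> x _; rewrite lee_fin.
- exact: measurable_sum_logkernel.
- by move=> x _; rewrite lee_fin.
- exact: measurable_sum_logkernel.
apply: ge0_le_integral => //=.
- move=> x _; rewrite lee_fin.
  by apply: sumr_ge0 => i _; rewrite !mulr_ge0 ?powR_ge0 ?logkernel_ge0.
- exact: measurable_sum_logkernel.
- by apply: emeasurable_funD; exact: measurable_sum_logkernel.
move=> x _; rewrite -EFinD lee_fin.
have l0 : 0 < expR x by exact: expR_gt0.
have shiftE (a : R) : 0 < a -> expR (x - ln a) = expR x / a.
  by move=> a0; rewrite expRD expRN lnK ?posrE.
have e0 (a : R) : 0 < a -> (expR x + a != 0) by move=> a0; rewrite gt_eqF // addr_gt0.
have shiftM c (a : R) : expR (c * (x - ln a)) = expR (c * x) * expR (- (c * ln a)).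
  by rewrite mulrBr expRD.
have -> : f0 x = expR ((tau - 1) * x) *
    \sum_j al j * (expR x * t j / (expR x + t j)).
  rewrite mulr_sumr; apply: eq_bigr => j _; rewrite /logkernel powE // shiftM shiftE // expRN.
  have -> : expR (tau * x) = expR ((tau - 1) * x) * expR x by rewrite -expRD; congr expR; ring.
  field; rewrite e0 // gt_eqF //= gt_eqF ?expR_gt0 //.
have -> : f1 x = expR ((tau - 1) * x) *
    \sum_i be i * (expR x * (rho i / (expR x + rho i)) ^+ 2).
  rewrite mulr_sumr; apply: eq_bigr => j _; rewrite /logkernel powE // shiftM shiftE // expRN.
  have -> : expR (tau * x) = expR ((tau - 1) * x) * expR x by rewrite -expRD; congr expR; ring.
  field; rewrite e0 // gt_eqF //= gt_eqF ?expR_gt0 //.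
have -> : f2 x = expR ((tau - 1) * x) *
    \sum_i ga i * (expR x / (expR x + rho' i)) ^+ 2.
  rewrite mulr_sumr; apply: eq_bigr => j _; rewrite /logkernel powE // shiftM shiftE // expRN.
  have -> : expR ((tau + 1) * x) = expR ((tau - 1) * x) * expR x ^+ 2.
    by rewrite expr2 -!expRD; congr expR; ring.
  have -> : expR ((tau + 1) * ln (rho' j)) = expR ((tau - 1) * ln (rho' j)) * rho' j ^+ 2.
    rewrite -{3}[rho' j]lnK ?posrE // expr2 -!expRD; congr expR; ring.
  field; rewrite e0 // gt_eqF //= gt_eqF ?expR_gt0 //.
rewrite -mulrDr ler_wpM2l ?expR_ge0 //.
exact: H.
Qed.

End PowerRepresentation.

(** * The scalar Stroock-Varopoulos inequality *)

Section ScalarInequality.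
Context {R : realType}.
Implicit Types (x y p th w : R).
Local Open Scope classical_set_scope.

(** Convexity of sinh: the difference vanishes at w = 0, and its derivative
    2 th (cosh w - cosh (th w)) is nonnegative. *)
Lemma sinh_contract th w : 0 <= th <= 1 -> 0 <= w ->
  expR (th * w) - expR (- (th * w)) <= th * (expR w - expR (- w)).
Proof.
move=> /andP[th0 th1] w0.
pose f (w : R) := th * (expR w - expR (- w)) - (expR (th * w) - expR (- (th * w))).
pose f' (w : R) := th * (expR w + expR (- w) - expR (th * w) - expR (- (th * w))).
have df (v : R) : is_derive v (1 : R) f (f' v).
  rewrite /f /f'; apply: is_derive_eq.
  rewrite /GRing.scale /=; ring.
have f'0 (v : R) : 0 <= v -> 0 <= f' v.
  move=> v0; rewrite mulr_ge0 //.
  have -> : expR v + expR (- v) - expR (th * v) - expR (- (th * v)) =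
      (expR v - expR (th * v)) * (1 - expR (- v - th * v)).
    rewrite mulrBr mulr1 mulrBl -!expRD.
    have -> : v + (- v - th * v) = - (th * v) by ring.
    have -> : th * v + (- v - th * v) = - v by ring.
    by ring.
  have tv : th * v <= v by rewrite ler_piMl.
  rewrite mulr_ge0 // subr_ge0 ?ler_expR // -expR0 ler_expR.
  by rewrite -opprD oppr_le0 addr_ge0 // mulr_ge0.
have : f 0 <= f w.
  apply: (@ger0_derive1_ndecry R f 0) => //.
  - move=> v; rewrite in_itv /= andbT => v0.
    by rewrite derive1E (@derive_val _ _ _ _ _ _ _ (df v)) f'0 // ltW.
  - by apply: continuous_subspaceT => v; apply: differentiable_continuous; apply/derivable1_diffP.
by rewrite /f !mulr0 oppr0 expR0 !subrr mulr0 subrr subr_ge0.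
Qed.

Lemma sinh_contract_sqr th w : 0 <= th <= 1 ->
  (expR (th * w) - expR (- (th * w))) ^+ 2 <= th ^+ 2 * (expR w - expR (- w)) ^+ 2.
Proof.
move=> th01; rewrite -exprMn.
wlog w0 : w / 0 <= w => [H|].
  have [/H //|/ltW w0] := leP 0 w.
  have := H (- w); rewrite oppr_ge0 => /(_ w0).
  have sN (u v : R) : (u - v) ^+ 2 = (v - u) ^+ 2 by ring.
  by rewrite mulrN !opprK => h; rewrite (sN (expR (th * w))) exprMn (sN (expR w)) -exprMn.
have le0 (v : R) : 0 <= v -> 0 <= expR v - expR (- v).
  by move=> v0; rewrite subr_ge0 ler_expR -subr_ge0 opprK addr_ge0.
have [th0 th1] := andP th01.
by rewrite lerXn2r ?nnegrE ?mulr_ge0 ?le0 ?mulr_ge0 // sinh_contract.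
Qed.

(** For x = expR a and y = expR b, let t = (a - b) / 2, S1 = 2 sinh (p t / 2)
    and S2 = 2 sinh ((2 - p) t / 2). Up to the factor (x y) ^ (p/2) the left
    side is S1 ^ 2 and the product of differences is S1 ^ 2 - S2 ^ 2. By
    convexity S2 ^ 2 <= th ^ 2 S1 ^ 2 with th = (2 - p) / p, and
    p ^ 2 (1 - th ^ 2) = 4 (p - 1). *)
Lemma stroock_varopoulos_scalar p x y : 1 < p <= 2 -> 0 < x -> 0 < y ->
  (x `^ (p / 2) - y `^ (p / 2)) ^+ 2 <=
  p ^+ 2 / (4 * (p - 1)) * ((x - y) * (x `^ (p - 1) - y `^ (p - 1))).
Proof.
move=> /andP[p1 p2] x0 y0.
pose a := ln x; pose b := ln y.
have -> : x = expR a by rewrite lnK.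
have -> : y = expR b by rewrite lnK.
rewrite -!expRM.
pose t := (a - b) / 2; pose m := expR (p * (a + b) / 4).
have Em c d : c + d = p * (a + b) / 2 -> expR c * expR d = m ^+ 2.
  by move=> cd; rewrite -expRD cd expr2 -expRD; congr expR; field.
have m0 : 0 < m by exact: expR_gt0.
pose th := (2 - p) / p; pose w := p * t / 2.
have p0 : 0 < p by apply: lt_trans p1.
have th01 : 0 <= th <= 1.
  rewrite /th; apply/andP; split; first by rewrite divr_ge0 ?subr_ge0 // ltW.
  by rewrite ler_pdivrMr // mul1r; lra.
have := sinh_contract_sqr w th01.
set S1 := expR w - _; set S2 := expR (th * w) - _ => S12.
have -> : expR (a * (p / 2)) - expR (b * (p / 2)) = m * S1.
  rewrite mulrBr -!expRD; by congr (expR _ - expR _); rewrite /w /t; field.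
have -> : (expR a - expR b) * (expR (a * (p - 1)) - expR (b * (p - 1))) =
    m ^+ 2 * (S1 ^+ 2 - S2 ^+ 2).
  have Ew : expR w * expR (- w) = 1 by rewrite -expRD subrr expR0.
  have Et : expR (th * w) * expR (- (th * w)) = 1 by rewrite -expRD subrr expR0.
  have -> : S1 ^+ 2 - S2 ^+ 2 = expR w ^+ 2 + expR (- w) ^+ 2
      - expR (th * w) ^+ 2 - expR (- (th * w)) ^+ 2.
    by rewrite /S1 /S2; ring: Ew Et.
  have mulBB (u v u' v' : R) : (u - v) * (u' - v') = u * u' - u * v' - (v * u' - v * v') by ring.
  rewrite mulBB -!expRD.
  have -> : a + a * (p - 1) = p * (a + b) / 4 * 2 + w * 2 by rewrite /w /t; field.
  have -> : b + b * (p - 1) = p * (a + b) / 4 * 2 + - w * 2 by rewrite /w /t; field.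
  have -> : a + b * (p - 1) = p * (a + b) / 4 * 2 + th * w * 2.
    by rewrite /th /w /t; field; rewrite gt_eqF.
  have -> : b + a * (p - 1) = p * (a + b) / 4 * 2 + - (th * w) * 2.
    by rewrite /th /w /t; field; rewrite gt_eqF.
  by rewrite !expRD !expRM_natr -/m; ring.
rewrite exprMn [leRHS]mulrCA ler_wpM2l ?exprn_ge0 ?(ltW m0) //.
have p10 : 0 < p - 1 by rewrite subr_gt0.
have S1E : S1 ^+ 2 = p ^+ 2 / (4 * (p - 1)) * (S1 ^+ 2 - th ^+ 2 * S1 ^+ 2).
  by rewrite /th; field; rewrite !gt_eqF.
rewrite [leLHS]S1E ler_wpM2l ?lerB //.
by rewrite divr_ge0 ?exprn_ge0 ?mulr_ge0 ?(ltW p0) ?(ltW p10).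
Qed.

End ScalarInequality.

(** * Unitary diagonalisation *)

Section UnitaryDiagonalisation.
Variables (C : numClosedFieldType).
Implicit Types (n : nat).

Definition unitary_diag n (V : 'M[C]_n) (d : 'rV[C]_n) : 'M[C]_n :=
  V^t* *m diag_mx d *m V.

Lemma unitary_mulVK n (V : 'M[C]_n) m (B : 'M[C]_(m, n)) : V \is unitarymx -> B *m V^t* *m V = B.
Proof. by move=> Vu; rewrite mulmxKtV. Qed.

Lemma unitary_mulKV n (V : 'M[C]_n) m (B : 'M[C]_(m, n)) : V \is unitarymx -> B *m V *m V^t* = B.
Proof. by move=> Vu; rewrite mulmxtVK. Qed.

Lemma unitary_mulCV n (V : 'M[C]_n) : V \is unitarymx -> V^t* *m V = 1%:M.
Proof. by move=> Vu; rewrite -[LHS]mul1mx mulmxA unitary_mulVK. Qed.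

Lemma unitary_mul_adj n (U V : 'M[C]_n) :
  U \is unitarymx -> V \is unitarymx -> U *m V^t* \is unitarymx.
Proof. by move=> Uu Vu; apply: mul_unitarymx; rewrite ?trmxC_unitary. Qed.

Lemma unitary_diagM n (V : 'M[C]_n) (d : 'rV[C]_n) e : V \is unitarymx ->
  unitary_diag V d *m unitary_diag V e = unitary_diag V (\row_i (d 0 i * e 0 i)).
Proof.
move=> Vu; rewrite /unitary_diag !mulmxA unitary_mulKV //.
by rewrite -(mulmxA (V^t*) (diag_mx _) (diag_mx _)) mulmx_diag.
Qed.

Lemma unitary_diagC n (V : 'M[C]_n) (d : 'rV[C]_n) : d \is a realmx ->
  (unitary_diag V d)^t* = unitary_diag V d.
Proof.
move=> dR; rewrite /unitary_diag !trmx_mul !map_mxM /= trmxCK mulmxA.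
by rewrite tr_diag_mx map_diag_mx (realmxC dR).
Qed.

Lemma unitary_diag_tr n (V : 'M[C]_n) (d : 'rV[C]_n) : V \is unitarymx ->
  \tr (unitary_diag V d) = \sum_i d 0 i.
Proof.
by move=> Vu; rewrite /unitary_diag mxtrace_mulC mulmxA (unitarymxP Vu) mul1mx mxtrace_diag.
Qed.

Lemma unitary_diag_normal n (V : 'M[C]_n) (d : 'rV[C]_n) : V \is unitarymx ->
  unitary_diag V d \is normalmx.
Proof.
move=> Vu; apply/orthomx_spectral_subproof; exists (V, d) => //=.
by rewrite invmx_unitary.
Qed.

(** A function of a normal matrix can be computed in any unitary
    diagonalisation: if W intertwines two of them, a nonzero entry of W forces
    the corresponding eigenvalues to be equal, hence also their images by g. *)
Lemma spectral_map_unitary_diag n (V : 'M[C]_n) (d : 'rV[C]_n) (g : C -> C) : V \is unitarymx ->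
  let A := unitary_diag V d in
  invmx (spectralmx A) *m diag_mx (map_mx g (spectral_diag A)) *m spectralmx A
  = unitary_diag V (map_mx g d).
Proof.
move=> Vu A.
have /orthomx_spectralP := unitary_diag_normal d Vu; rewrite -/A.
set P := spectralmx A; set sp := spectral_diag A.
have Pu : P \is unitarymx by apply: spectral_unitarymx.
rewrite invmx_unitary // => AE.
have [W WE0] : {W | W = V *m P^t*} by exists (V *m P^t*).
have WE i j : d 0 i * W i j = W i j * sp 0 j.
  have /matrixP/(_ i j) : diag_mx d *m W = W *m diag_mx sp.
    have : V *m A *m P^t* = V *m (P^t* *m diag_mx sp *m P) *m P^t* by rewrite -AE.
    by rewrite /A /unitary_diag !mulmxA (unitarymxP Vu) mul1mx (unitary_mulKV _ Pu) WE0 ?mulmxA.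
  by rewrite mul_diag_mx mul_mx_diag !mxE.
have WfE : diag_mx (map_mx g d) *m W = W *m diag_mx (map_mx g sp).
  apply/matrixP => i j; rewrite mul_diag_mx mul_mx_diag !mxE.
  have := WE i j; set w := W i j.
  have [-> _ | w0] := eqVneq w 0; first by rewrite mulr0 mul0r.
  by rewrite mulrC => /(mulfI w0) ->; rewrite mulrC.
rewrite /unitary_diag -[RHS](unitary_mulVK _ Pu) -![in RHS]mulmxA.
rewrite (mulmxA V) -WE0 (mulmxA (diag_mx _) W) WfE WE0 !mulmxA.
by rewrite (unitary_mulCV Vu) mul1mx.
Qed.

(** Polarisation of the real-valued form at e_i + e_j and e_i + 'i e_j. *)
Lemma form_ge0_hermitian n (A : 'M[C]_n) :
  (forall v : 'cV[C]_n, 0 <= (v^t* *m A *m v) 0 0) -> A^t* = A.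
Proof.
move=> psdA; pose q (B : 'M[C]_n) (v : 'cV[C]_n) := (v^t* *m B *m v) 0 0.
have qA v : q (A^t*) v = q A v.
  have := psdA v; rewrite -/(q A v) => /ger0_real/CrealP <-.
  transitivity (((v^t* *m A *m v)^t*) 0 0); last by rewrite mxE mxE.
  by rewrite !trmx_mul !map_mxM /= trmxCK mulmxA.
have [B BE] : {B | B = A^t* - A} by exists (A^t* - A).
have qB v : q B v = 0.
  have -> : q B v = q (A^t*) v - q A v by rewrite /q BE mulmxBr mulmxBl mxE [X in _ + X]mxE.
  by rewrite qA subrr.
have eB i j : (delta_mx 0 i : 'rV[C]_n) *m B *m delta_mx j 0 = (B i j)%:M.
  by rewrite -rowE -colE; apply/matrixP => a b; rewrite !ord1 !mxE eqxx mulr1n.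
have dC i : (delta_mx i 0 : 'cV[C]_n)^t* = delta_mx 0 i.
  by rewrite trmx_delta map_delta_mx.
have addC c (u v : 'cV[C]_n) : (u + c *: v)^t* = u^t* + c^* *: v^t*.
  by apply/matrixP => a b; rewrite !mxE rmorphD rmorphM.
have qE c i j : c * B i j + c^* * B j i = 0.
  have := qB (delta_mx i 0 + c *: delta_mx j 0).
  have := qB (delta_mx i 0); have := qB (delta_mx j 0).
  rewrite /q addC !dC !mulmxDl !mulmxDr.
  rewrite -!scalemxAl -!scalemxAr !eB !mxE !eqxx !mulr1n => -> ->.
  by rewrite !mulr0 add0r addr0 addrC.
apply/subr0_eq; rewrite -BE; apply/matrixP => i j; rewrite [RHS]mxE.
have := qE 1 i j; rewrite rmorph1 !mul1r => /eqP; rewrite addr_eq0 => /eqP h1.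
have := qE 'i i j; rewrite conjCi h1 mulrN mulNr -opprD => /eqP.
rewrite oppr_eq0 -mulr2n mulrn_eq0 /= mulf_eq0 (negPf (neq0Ci _)) /= => /eqP ->.
by rewrite oppr0.
Qed.

Lemma unitary_diag_form n (V : 'M[C]_n) (d : 'rV[C]_n) i : V \is unitarymx ->
  ((row i V) *m unitary_diag V d *m (row i V)^t*) 0 0 = d 0 i.
Proof.
move=> Vu; rewrite rowE trmx_mul map_mxM /= trmx_delta map_delta_mx /unitary_diag.
rewrite !mulmxA (unitary_mulKV _ Vu) -!mulmxA (mulmxA V) (unitarymxP Vu) mul1mx.
by rewrite mulmxA -rowE -colE !mxE eqxx mulr1n.
Qed.

Lemma row_unitary_neq0 n (V : 'M[C]_n) i : V \is unitarymx -> (row i V)^t* != 0.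
Proof.
move=> Vu; apply/eqP => V0.
have : (row i V *m (row i V)^t*) 0 0 = 0 by rewrite V0 mulmx0 mxE.
rewrite rowE trmx_mul map_mxM /= trmx_delta map_delta_mx mulmxA -(mulmxA _ V).
rewrite (unitarymxP Vu) mulmx1 mul_delta_mx mxE !eqxx => /eqP.
by rewrite oner_eq0.
Qed.

Lemma form_ge0_unitary_diag n (A : 'M[C]_n) :
  (forall v : 'cV[C]_n, 0 <= (v^t* *m A *m v) 0 0) ->
  exists (V : 'M[C]_n) (d : 'rV[C]_n),
    [/\ V \is unitarymx, forall i, 0 <= d 0 i & A = unitary_diag V d].
Proof.
move=> psdA; have hA := form_ge0_hermitian psdA.
have hermA : A \is hermsymmx by apply/is_hermitianmxP; rewrite expr0 scale1r hA.
have /orthomx_spectralP AE := hermitian_normalmx hermA.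
have Pu := spectral_unitarymx A; rewrite invmx_unitary // in AE.
exists (spectralmx A), (spectral_diag A); split => // i.
rewrite -(unitary_diag_form _ i Pu) /unitary_diag -AE.
by have := psdA ((row i (spectralmx A))^t*); rewrite trmxCK.
Qed.

Lemma unitary_diag_form_ge0 n (V : 'M[C]_n) (d : 'rV[C]_n) : (forall i, 0 <= d 0 i) ->
  forall v : 'cV[C]_n, 0 <= (v^t* *m unitary_diag V d *m v) 0 0.
Proof.
move=> d0 v; rewrite /unitary_diag !mulmxA -(mulmxA _ V v).
have -> : v^t* *m V^t* = (V *m v)^t* by rewrite trmx_mul map_mxM.
set w := V *m v; rewrite -mulmxA mul_diag_mx !mxE; apply: sumr_ge0 => i _.
by rewrite !mxE mulrCA mulr_ge0 // mulrC mul_conjC_ge0.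
Qed.

Lemma unitary_diag_unit n (V : 'M[C]_n) (d : 'rV[C]_n) i : V \is unitarymx ->
  unitary_diag V d \in unitmx -> d 0 i != 0.
Proof.
move=> Vu Au; apply/eqP => di0.
have : row i V *m unitary_diag V d = 0.
  rewrite /unitary_diag rowE !mulmxA (unitary_mulKV _ Vu) -rowE.
  by rewrite row_diag_mx di0 scale0r mul0mx.
move/(congr1 (mulmx^~ (invmx (unitary_diag V d)))); rewrite mulmxK // mul0mx => V0.
by have := row_unitary_neq0 i Vu; rewrite V0 trmx0 map_mx0 eqxx.
Qed.

Lemma form_gt0_congr n (A B : 'M[C]_n) :
  (forall v : 'cV[C]_n, v != 0 -> 0 < (v^t* *m A *m v) 0 0) -> B \in unitmx ->
  (forall v : 'cV[C]_n, v != 0 -> 0 < (v^t* *m (B^t* *m A *m B) *m v) 0 0).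
Proof.
move=> pA Bu v v0; rewrite !mulmxA -(mulmxA _ B v).
have -> : v^t* *m B^t* = (B *m v)^t* by rewrite trmx_mul map_mxM.
apply: pA; apply: contra_neq v0 => /(congr1 (mulmx (invmx B))).
by rewrite mulKmx // mulmx0.
Qed.

End UnitaryDiagonalisation.

(** * Limits of forms, Choi forms and generators *)

Section LimitsOfForms.
Variable (C : numClosedFieldType).
Context {T : Type} {F : set_system T} {FF : ProperFilter F}.
Local Open Scope classical_set_scope.

Lemma cvg_sum_fin (I : finType) (f : I -> T -> C^o) (a : I -> C^o) :
  (forall i, f i @ F --> a i) -> (fun t => \sum_i f i t) @ F --> \sum_i a i.
Proof. by move=> fa; apply: cvg_big => //; exact: add_continuous. Qed.

Lemma cvg_mx_form n (f : T -> 'M[C^o]_n) (A : 'M[C^o]_n) (u : 'rV[C]_n) (v : 'cV[C]_n) :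
  f @ F --> A ->
  (fun t => (u *m (f t : 'M[C]_n) *m v) 0 0 : C^o) @ F --> ((u *m (A : 'M[C]_n) *m v) 0 0 : C^o).
Proof.
move=> fA; have E (B : 'M[C]_n) :
    (u *m B *m v) 0 0 = \sum_j \sum_i ((u 0 i * B i j) * v j 0 : C^o).
  by rewrite mxE; apply: eq_bigr => j _; rewrite mxE mulr_suml.
rewrite E; under eq_fun do rewrite E.
apply: cvg_sum_fin => j; apply: cvg_sum_fin => i.
apply: (@cvgMr_tmp C^o); apply: (@cvgMl_tmp C^o).
exact: (cvg_comp _ _ fA (@coord_continuous C^o n n i j A)).
Qed.

(** The nonnegative elements are the a with |a| = a, a closed condition. *)
Lemma cvg_ge0 (f : T -> C^o) (a : C^o) : f @ F --> a ->
  (\forall t \near F, 0 <= (f t : C)) -> 0 <= (a : C).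
Proof.
move=> fa f0; have na : (fun t => `|f t| : C^o) @ F --> (`|a| : C^o) by exact: cvg_norm.
have na' : (fun t => `|f t| : C^o) @ F --> a.
  apply: cvg_trans fa; apply: near_eq_cvg; near=> t.
  by rewrite ger0_norm //; near: t.
by have <- : `|a| = a :> C by exact: (cvg_unique _ na na').
Unshelve. all: end_near. Qed.

Lemma cvg_conj (f : T -> C^o) (a : C^o) : f @ F --> a ->
  (fun t => ((f t : C)^* : C^o)) @ F --> ((a : C)^* : C^o).
Proof.
move=> /cvgrPdist_lt fa; apply/cvgrPdist_lt => e e0.
near=> t; rewrite -rmorphB norm_conjC; near: t; exact: fa.
Unshelve. all: end_near. Qed.

End LimitsOfForms.

Lemma rank1_form_ge0 (C : numClosedFieldType) n (y v : 'cV[C]_n) :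
  0 <= (v^t* *m (y *m y^t*) *m v) 0 0.
Proof.
have -> : v^t* *m (y *m y^t*) *m v = (v^t* *m y) *m (v^t* *m y)^t*.
  by rewrite trmx_mul map_mxM /= trmxCK !mulmxA.
by rewrite mxE big_ord1 !mxE mul_conjC_ge0.
Qed.

Lemma adjmxE (C : numClosedFieldType) m n (A : 'M[C]_(m, n)) i j : A^t* i j = (A j i)^*.
Proof. by rewrite !mxE. Qed.

Lemma adjmxZ_real (C : numClosedFieldType) m n c (A : 'M[C]_(m, n)) :
  c \is Num.real -> (c *: A)^t* = c *: A^t*.
Proof. by move=> cR; apply/matrixP => i j; rewrite !mxE rmorphM /= conj_Creal. Qed.

Section ChoiForm.
Variables (R : realType) (n : nat).
Local Notation C := R[i]%C.
Local Notation M := 'M[C]_n.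

(** The quadratic form of the Choi matrix of F. When F is conjugation
    X |-> K X K^* it is the square modulus of the sum of the <w a, K (x a)>. *)
Definition choi_form k (F : M -> M) (x w : 'I_k -> 'cV[C]_n) : C :=
  \sum_a \sum_b ((w a)^t* *m F (x a *m (x b)^t*) *m w b) 0 0.

(** The vector of C^k (x) C^n with components [x a]; its rank-one projection
    has the blocks |x a><x b|. *)
Definition choi_vec k (x : 'I_k -> 'cV[C]_n) : 'cV[C]_(k * n) :=
  \col_u x (mxtens.mxtens_unindex u).1 (mxtens.mxtens_unindex u).2 0.

Lemma choi_vecE k (x : 'I_k -> 'cV[C]_n) a i :
  choi_vec x (mxtens.mxtens_index (a, i)) 0 = x a i 0.
Proof. by rewrite mxE mxtens.mxtens_indexK. Qed.

Lemma ampliation_rank1 k (F : M -> M) (x : 'I_k -> 'cV[C]_n) a i b j :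
  ampliation F (choi_vec x *m (choi_vec x)^t*)
    (mxtens.mxtens_index (a, i)) (mxtens.mxtens_index (b, j))
  = F (x a *m (x b)^t*) i j.
Proof.
rewrite mxE !mxtens.mxtens_indexK; congr (F _ _ _).
apply/matrixP => i' j'; rewrite mxE.
rewrite [LHS]mxE big_ord1 [RHS]mxE big_ord1 choi_vecE.
by rewrite !adjmxE choi_vecE.
Qed.

Lemma choi_formE k (F : M -> M) (x w : 'I_k -> 'cV[C]_n) :
  choi_form F x w =
  ((choi_vec w)^t* *m ampliation F (choi_vec x *m (choi_vec x)^t*) *m choi_vec w) 0 0.
Proof.
set Z := ampliation _ _; rewrite mxE.
have -> : \sum_j ((choi_vec w)^t* *m Z) 0 j * choi_vec w j 0 =
    \sum_j \sum_i (choi_vec w i 0)^* * Z i j * choi_vec w j 0.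
  apply: eq_bigr => j _; rewrite mxE mulr_suml; apply: eq_bigr => i _.
  by rewrite adjmxE.
rewrite exchange_big /=.
have bij : bijective (@mxtens.mxtens_index k n).
  by exists (@mxtens.mxtens_unindex k n);
    [exact: mxtens.mxtens_indexK | exact: mxtens.mxtens_unindexK].
have re (G : 'I_(k * n) -> C) : \sum_u G u = \sum_a \sum_i G (mxtens.mxtens_index (a, i)).
  by rewrite (reindex _ (onW_bij _ bij)) /= pair_bigA /=; apply: eq_bigr => -[].
rewrite re; apply: eq_bigr => a _.
under [in RHS]eq_bigr => i _ do rewrite re.
rewrite exchange_big /=; apply: eq_bigr => b _.
rewrite mxE exchange_big /=; apply: eq_bigr => j _.
rewrite mxE mulr_suml; apply: eq_bigr => i _.
by rewrite ampliation_rank1 !choi_vecE adjmxE.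
Qed.

Lemma cp_choi_form_ge0 k (F : M -> M) (x w : 'I_k -> 'cV[C]_n) :
  completely_positive F -> 0 <= choi_form F x w.
Proof.
move=> cpF; rewrite choi_formE.
by apply: cpF => v; exact: rank1_form_ge0.
Qed.

(** The matrix of the blocks F (|x a><x b|) is positive semidefinite,
    hence hermitian. *)
Lemma cp_conj k (F : M -> M) (x : 'I_k -> 'cV[C]_n) a b : completely_positive F ->
  (F (x a *m (x b)^t*))^t* = F (x b *m (x a)^t*).
Proof.
move=> cpF; have /form_ge0_hermitian : psdmx (ampliation F (choi_vec x *m (choi_vec x)^t*)).
  by apply: cpF => v; exact: rank1_form_ge0.
move=> /matrixP H; apply/matrixP => i j.
have := H (mxtens.mxtens_index (b, i)) (mxtens.mxtens_index (a, j)).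
by rewrite ampliation_rank1 => <-; rewrite !adjmxE ampliation_rank1.
Qed.

End ChoiForm.

Section Generator.
Variables (R : realType) (n : nat).
Local Notation C := R[i]%C.
Local Notation M := 'M[C]_n.
Variables (P : R -> {linear M -> M}) (L : {linear M -> M}).
Hypotheses (qmsP : QMS P) (genL : is_generator P L).
Local Open Scope classical_set_scope.

Let Q (t : R) (X : M) : M := (t^-1)%:C%C *: (P t X - X).

Lemma cvg_generator_entry X i j :
  (fun t => (Q t X : M) i j : C^o) @ 0^'+ --> (L X i j : C^o).
Proof.
exact: (cvg_comp _ _ (@genL X) (@coord_continuous C^o n n i j (L X))).
Qed.

Lemma generator_one : L 1%:M = 0.
Proof.
have [_ P1 _ _ _] := qmsP; apply/matrixP => i j; rewrite [RHS]mxE.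
have c0 : (fun t => (Q t 1%:M : M) i j : C^o) @ 0^'+ --> (0 : C^o).
  apply: cvg_trans (@cvg_cst _ (0 : C^o) _ (0^'+) _); apply: near_eq_cvg.
  near=> t; rewrite /Q P1; last by [].
  by rewrite subrr scaler0 mxE.
exact: (cvg_unique _ (@cvg_generator_entry _ i j) c0).
Unshelve. all: end_near. Qed.

Lemma generator_conj k (x : 'I_k -> 'cV[C]_n) a b :
  (L (x a *m (x b)^t*))^t* = L (x b *m (x a)^t*).
Proof.
have [cp _ _ _ _] := qmsP; apply/matrixP => i j; rewrite adjmxE.
set Xab := x a *m _; set Xba := x b *m _.
have c1 : (fun t => (((Q t Xab : M) j i)^* : C^o)) @ 0^'+ --> ((L Xab j i)^* : C^o).
  exact: cvg_conj (@cvg_generator_entry Xab j i).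
have c2 : (fun t => (((Q t Xab : M) j i)^* : C^o)) @ 0^'+ --> (L Xba i j : C^o).
  apply: cvg_trans (@cvg_generator_entry Xba i j); apply: near_eq_cvg.
  near=> t; have t0 : 0 <= t by [].
  rewrite -adjmxE /Q; congr (fun_of_matrix _ i j).
  have -> : (P t Xba - Xba) = (P t Xab - Xab)^t*.
    rewrite linearB map_mxB /= (cp_conj x a b (cp t t0)); congr (_ - _).
    by rewrite /Xab /Xba trmx_mul map_mxM /= trmxCK.
  have tr : (t^-1)%:C%C \is @Num.real C by apply/complex_realP; exists t^-1.
  by rewrite adjmxZ_real.
exact: (cvg_unique _ c1 c2).
Unshelve. all: end_near. Qed.

(** Conditional complete positivity. The Choi form of the identity is the square
    modulus of the sum of the <w a, x a>, which is assumed to vanish; the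
    form of (P t - id) / t is then that of P t divided by t. *)
Lemma generator_choi_form_ge0 k (x w : 'I_k -> 'cV[C]_n) :
  \sum_a ((w a)^t* *m x a) 0 0 = 0 -> 0 <= choi_form L x w.
Proof.
have [cp _ _ _ _] := qmsP => xw0.
apply: (@cvg_ge0 C R (0^'+) _ (fun t => choi_form (Q t) x w : C^o)).
  apply: cvg_sum_fin => a; apply: cvg_sum_fin => b.
  exact: cvg_mx_form (@genL _).
near=> t; have t0 : 0 < t by [].
have id0 : choi_form (fun X : M => X) x w = 0.
  transitivity ((\sum_a ((w a)^t* *m x a) 0 0) * (\sum_b ((x b)^t* *m w b) 0 0));
    last by rewrite xw0 mul0r.
  rewrite /choi_form mulr_suml.
  apply: eq_bigr => a _; rewrite mulr_sumr; apply: eq_bigr => b _.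
  by rewrite mulmxA -mulmxA mxE big_ord1.
have -> : choi_form (Q t) x w =
    (t^-1)%:C%C * (choi_form (P t) x w - choi_form (fun X : M => X) x w).
  rewrite /choi_form -sumrB mulr_sumr; apply: eq_bigr => a _.
  rewrite -sumrB mulr_sumr; apply: eq_bigr => b _.
  rewrite /Q -scalemxAr -scalemxAl mulmxBr mulmxBl.
  by rewrite mxE [X in _ * X]mxE [X in _ * (_ + X)]mxE.
rewrite id0 subr0 mulr_ge0 ?cp_choi_form_ge0 //; last exact/cp/ltW.
by rewrite ler0c invr_ge0 ltW.
Unshelve. all: end_near. Qed.

End Generator.

(** * Sums over a modular kernel *)

Section ModularKernel.
Variables (R : realType) (C : numClosedFieldType) (io : {rmorphism R -> C}) (n : nat).
Hypothesis io_ge0 : forall x, 0 <= x -> 0 <= io x.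
Variables (ell : 'I_n -> 'I_n -> 'I_n -> 'I_n -> C) (W : 'M[C]_n) (s : 'I_n -> R).
Hypotheses (s_gt0 : forall i, 0 < s i) (Wu : W \is unitarymx).
Hypothesis ell_conj : forall i j a b, (ell i j a b)^* = ell j i b a.
Hypothesis ell_gns : forall i j a b, io (s i) * ell i j a b = io (s a) * ell b a j i.
Hypothesis ell_one : forall i j, \sum_a ell i j a a = 0.
Hypothesis ell_pos : forall z : 'I_n -> 'I_n -> C, \sum_a z a a = 0 ->
  0 <= \sum_a \sum_b \sum_i \sum_j (z i a)^* * ell i j a b * z j b.

Lemma io_conj x : (io x)^* = io x.
Proof.
apply/CrealP; have [/io_ge0/ger0_real //|x0] := leP 0 x.
by rewrite -(opprK x) rmorphN rpredN ger0_real // io_ge0 // oppr_ge0 ltW.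
Qed.

Lemma ell_gns2 i j a b : io (s j) * ell i j a b = io (s b) * ell b a j i.
Proof.
have := ell_gns j i b a; move/(congr1 (fun z : C => z^*)).
by rewrite !rmorphM /= !io_conj !ell_conj.
Qed.

Lemma ell_swap i j a b : ell b a j i = io (s i / s a) * ell i j a b.
Proof.
have sa0 : io (s a) != 0 by rewrite fmorph_eq0 gt_eqF.
by apply: (mulfI sa0); rewrite -ell_gns mulrA -rmorphM mulrCA divff ?mulr1 ?gt_eqF.
Qed.

(** The coefficients commute with the modular group of sigma: [ell_gns] and its
    conjugate [ell_gns2] express ell b a j i in two ways. *)
Lemma ell_ratio i j a b : ell i j a b != 0 -> s i / s a = s j / s b.
Proof.
move=> l0; have sb0 : io (s b) != 0 by rewrite fmorph_eq0 gt_eqF.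
apply: (fmorph_inj io); apply: (mulIf l0); rewrite -ell_swap.
apply: (mulfI sb0); rewrite -ell_gns2 mulrA -rmorphM mulrCA divff ?mulr1 //.
by rewrite gt_eqF.
Qed.

(** The indices ((k, l), (i, a), (j, b)): k and l number eigenvectors of A,
    the four others eigenvectors of sigma. *)
Definition index6 := (('I_n * 'I_n) * ('I_n * 'I_n) * ('I_n * 'I_n))%type.

(** <v_k, u_i><u_a, v_l> ell i j a b <u_j, v_k><v_l, u_b>, with W the matrix
    of scalar products between the two eigenbases. *)
Definition weight (u : index6) : C :=
  let: ((k, l), (i, a), (j, b)) := u in
  (W i k)^* * W a l * W j k * (W b l)^* * ell i j a b.

Lemma sum_index6 (F : index6 -> C) : \sum_u F u =
  \sum_k \sum_l \sum_i \sum_a \sum_j \sum_b F ((k, l), (i, a), (j, b)).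
Proof.
have E (A B : finType) (G : A * B -> C) : \sum_u G u = \sum_x \sum_y G (x, y).
  by rewrite pair_bigA; apply: eq_bigr => -[].
rewrite E E E; apply: eq_bigr => k _; apply: eq_bigr => l _; rewrite E.
by apply: eq_bigr => i _; apply: eq_bigr => a _; rewrite E.
Qed.

Definition kernel_sum (g : index6 -> R) : C := \sum_u io (g u) * weight u.

Lemma sum_row_unitary a b : \sum_l W a l * (W b l)^* = (a == b)%:R.
Proof.
have /unitarymxP/matrixP/(_ a b) := Wu; rewrite !mxE => <-.
by apply: eq_bigr => l _; rewrite !mxE.
Qed.

Lemma sum_col_unitary k l : \sum_i (W i k)^* * W i l = (k == l)%:R.
Proof.
have /matrixP/(_ k l) := unitary_mulCV Wu; rewrite !mxE => <-.
by apply: eq_bigr => i _; rewrite !mxE.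
Qed.

(** Summing over l gives the identity, on which L vanishes. *)
Lemma kernel_sum_one (f : 'I_n -> R) :
  kernel_sum (fun u => let: ((k, _), _, _) := u in f k) = 0.
Proof.
rewrite /kernel_sum sum_index6; apply: big1 => k _.
transitivity (io (f k) * \sum_i \sum_j ((W i k)^* * W j k * \sum_a ell i j a a)).
  rewrite exchange_big /= mulr_sumr; apply: eq_bigr => i _.
  under eq_bigr => l _ do rewrite exchange_big /=.
  rewrite exchange_big /= mulr_sumr; apply: eq_bigr => j _.
  rewrite exchange_big /= !mulr_sumr; apply: eq_bigr => a _.
  rewrite exchange_big /=.
  transitivity (\sum_b io (f k) * ((W i k)^* * W j k) * (a == b)%:R * ell i j a b).
    apply: eq_bigr => b _; rewrite -sum_row_unitary mulr_sumr mulr_suml.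
    by apply: eq_bigr => l _; rewrite /weight; ring.
  rewrite (bigD1 a) //= big1 ?addr0; last by move=> b /negPf ab; rewrite eq_sym ab mulr0 mul0r.
  by rewrite eqxx mulr1 -!mulrA.
under eq_bigr => i _ do under eq_bigr => j _ do rewrite ell_one mulr0.
by rewrite big1 ?mulr0 // => i _; rewrite big1.
Qed.

Definition swap6 (u : index6) : index6 :=
  let: ((k, l), (i, a), (j, b)) := u in ((l, k), (b, j), (a, i)).

Lemma swap6K : involutive swap6.
Proof. by case=> [[[k l] [i a]] [j b]]. Qed.

(** The reversibility of L: exchanging k with l and (i, a) with (b, j) multiplies
    the weight by s i / s a. *)
Lemma kernel_sum_swap (g g' : index6 -> R) :
  (forall k l i a j b, s i / s a = s j / s b ->
     g ((l, k), (b, j), (a, i)) * (s i / s a) = g' ((k, l), (i, a), (j, b))) ->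
  kernel_sum g = kernel_sum g'.
Proof.
move=> gg'; rewrite /kernel_sum (reindex_inj (inv_inj swap6K)) /=.
apply: eq_bigr => -[[[k l] [i a]] [j b]] _ /=.
have [l0|l0] := eqVneq (ell i j a b) 0.
  by rewrite ell_swap l0; ring.
by rewrite ell_swap -(gg' _ _ _ _ _ _ (ell_ratio l0)) rmorphM; ring.
Qed.

(** Where ell is nonzero, g takes the same value at the ratios s i / s a and
    s j / s b, so that for fixed k and l the sum is the Choi form at
    z i a = sqrt (g k l (s i / s a)) W i k (W a l)^*. The trace of z is
    sqrt (g k l 1) <v_l, v_k>, which is zero, either by orthogonality or
    because g k k 1 = 0. *)
Lemma kernel_sum_ge0 (g : 'I_n -> 'I_n -> R -> R) :
  (forall k l r, 0 < r -> 0 <= g k l r) -> (forall k, g k k 1 = 0) ->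
  0 <= kernel_sum (fun u => let: ((k, l), (i, a), _) := u in g k l (s i / s a)).
Proof.
move=> g0 gkk; rewrite /kernel_sum sum_index6.
apply: sumr_ge0 => k _; apply: sumr_ge0 => l _.
pose z i a := io (Num.sqrt (g k l (s i / s a))) * W i k * (W a l)^*.
have z0 : \sum_a z a a = 0.
  transitivity (io (Num.sqrt (g k l 1)) * \sum_a (W a l)^* * W a k).
    rewrite mulr_sumr; apply: eq_bigr => a _.
    by rewrite /z divff ?gt_eqF //; ring.
  rewrite sum_col_unitary; have [->|_] := eqVneq l k; last by rewrite mulr0.
  by rewrite gkk sqrtr0 rmorph0 mul0r.
apply: le_trans (ell_pos z0) _; rewrite le_eqVlt; apply/orP; left; apply/eqP.
rewrite [RHS]exchange_big /=; apply: eq_bigr => a _.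
under [RHS]eq_bigr => i _ do rewrite exchange_big /=.
rewrite [RHS]exchange_big /=; apply: eq_bigr => b _.
apply: eq_bigr => i _; apply: eq_bigr => j _.
rewrite /z /weight; have [l0|l0] := eqVneq (ell i j a b) 0.
  by rewrite l0; ring.
rewrite !rmorphM /= conjCK io_conj -(ell_ratio l0).
have -> : io (g k l (s i / s a)) =
    io (Num.sqrt (g k l (s i / s a))) * io (Num.sqrt (g k l (s i / s a))).
  by rewrite -rmorphM -expr2 sqr_sqrtr // g0 // divr_gt0.
ring.
Qed.

Lemma eq_kernel_sum (g g' : index6 -> R) :
  (forall k l i a j b, s i / s a = s j / s b ->
     g ((k, l), (i, a), (j, b)) = g' ((k, l), (i, a), (j, b))) ->
  kernel_sum g = kernel_sum g'.
Proof.
move=> gg'; apply: eq_bigr => -[[[k l] [i a]] [j b]] _ /=.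
have [l0|l0] := eqVneq (ell i j a b) 0; first by rewrite l0; ring.
by rewrite (gg' _ _ _ _ _ _ (ell_ratio l0)).
Qed.

Lemma kernel_sumD (g g' : index6 -> R) :
  kernel_sum (fun u => g u + g' u) = kernel_sum g + kernel_sum g'.
Proof. by rewrite /kernel_sum -big_split; apply: eq_bigr => u _; rewrite rmorphD mulrDl. Qed.

Lemma kernel_sumZ c (g : index6 -> R) :
  kernel_sum (fun u => c * g u) = io c * kernel_sum g.
Proof. by rewrite /kernel_sum mulr_sumr; apply: eq_bigr => u _; rewrite rmorphM mulrA. Qed.

(** On the support of ell, where s i / s i' = s j / s j' = r, the last factor
    is r ^ (2 c). *)
Definition power_kernel (a : 'I_n -> R) (c al be : R) (u : index6) : R :=
  let: ((k, l), (i, i'), (j, j')) := u in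
  a k `^ al * a l `^ be *
  (s i `^ c * s j `^ c * (s i' `^ (- c) * s j' `^ (- c))).

(** With x = a k and y = a l * r ^ (1/p), the two kernels are
    x ^ (p/2) y ^ (p/2) and x ^ (p-1) y. The sums of x ^ p and y ^ p vanish, and
    x, y can be exchanged, so the difference of the two sides is half the sum
    of H, the difference of the two sides of the scalar inequality. *)
Lemma stroock_varopoulos_kernel (a : 'I_n -> R) p : (forall k, 0 < a k) -> 1 < p <= 2 ->
  - kernel_sum (power_kernel a 4^-1 (p / 2) (p / 2)) <=
  - (io (p ^+ 2 / (4 * (p - 1))) * kernel_sum (power_kernel a (2 * p)^-1 (p - 1) 1)).
Proof.
move=> a0 p12; have /andP[p1 p2] := p12.
have p0 : 0 < p by apply: lt_trans p1.
have p_neq0 : p != 0 by rewrite gt_eqF.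
have powE x t : 0 < x -> x `^ t = expR (t * ln x) :> R by move=> x0; rewrite /powR gt_eqF.
pose y k r := a k * r `^ p^-1.
have y0 k r : 0 < r -> 0 < y k r by move=> r0; rewrite mulr_gt0 ?powR_gt0.
have lny k r : 0 < r -> ln (y k r) = ln (a k) + p^-1 * ln r.
  by move=> r0; rewrite lnM ?posrE ?powR_gt0 // ln_powR.
have r0 i j : 0 < s i / s j by rewrite divr_gt0.
pose h (al be : R) (u : index6) := let: ((k, l), (i, i'), _) := u in
  a k `^ al * y l (s i / s i') `^ be.
have lnr i j : ln (s i / s j) = ln (s i) - ln (s j) by rewrite ln_div ?posrE.
(* On the support of ell, r ^ (2 c) = (r ^ (1/p)) ^ be. *)
have kE c al be : be = 2 * c * p ->
    kernel_sum (power_kernel a c al be) = kernel_sum (h al be).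
  move=> bE; apply: eq_kernel_sum => k l i i' j j' /= rE.
  rewrite -mulrA; congr (_ * _); rewrite !powE ?y0 // lny // -!expRD.
  congr expR; rewrite bE; move/(congr1 (@ln R)): rE; rewrite !lnr => rE.
  have -> : ln (s i) = ln (s j) - ln (s j') + ln (s i') by rewrite -rE; ring.
  by field.
(* Homogeneity of degree p absorbs the factor r of the exchange. *)
have hswap al be : al + be = p -> kernel_sum (h al be) = kernel_sum (h be al).
  move=> abp; apply: kernel_sum_swap => k l i i' j j' /= rE.
  rewrite -[X in _ * X](@lnK _ (s i / s i')) ?posrE // !powE ?y0 // !lny // -!expRD.
  congr expR; rewrite -abp in p_neq0 *.
  have -> : ln (s j' / s j) = - ln (s j / s j') by rewrite !lnr opprB.
  by rewrite -rE; field.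
have hp0 : kernel_sum (h p 0) = 0.
  rewrite -(kernel_sum_one (fun k => a k `^ p)).
  by apply: eq_kernel_sum => k l i i' j j' _; rewrite /h powRr0 mulr1.
have h0p : kernel_sum (h 0 p) = 0 by rewrite hswap ?add0r.
set c := p ^+ 2 / (4 * (p - 1)).
pose H k l r := c * ((a k - y l r) * (a k `^ (p - 1) - y l r `^ (p - 1))) -
  (a k `^ (p / 2) - y l r `^ (p / 2)) ^+ 2.
have H0 k l r : 0 < r -> 0 <= H k l r.
  by move=> r_gt0; rewrite subr_ge0 stroock_varopoulos_scalar ?y0.
have Hkk k : H k k 1 = 0 by rewrite /H /y powR1 mulr1 !subrr !mulr0 expr0n subrr.
have := kernel_sum_ge0 H0 Hkk.
rewrite (_ : kernel_sum _ = kernel_sum (fun u =>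
   ((c - 1) * h p 0 u + (c - 1) * h 0 p u) +
   ((- c) * h (p - 1) 1 u + (- c) * h 1 (p - 1) u) +
   2 * h (p / 2) (p / 2) u)); last first.
  apply: eq_kernel_sum => k l i i' j j' _; rewrite /H /h.
  have := y0 l _ (r0 i i'); set Y := y l _ => Y0; set X := a k.
  have X0 : 0 < X by exact: a0.
  rewrite !powRr0 !powRr1 ?ltW //.
  have half x : 0 < x -> x `^ (p / 2) ^+ 2 = x `^ p.
    by move=> x0; rewrite -powR_mulrn ?powR_ge0 // -powRrM divfK.
  have split x : 0 < x -> x `^ p = x * x `^ (p - 1).
    by move=> x0; rewrite -{2}[x]powRr1 ?ltW // -powRD ?gt_eqF ?implybT // addrC subrK.
  have -> : (X `^ (p / 2) - Y `^ (p / 2)) ^+ 2 =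
     X `^ p + Y `^ p - 2 * (X `^ (p / 2) * Y `^ (p / 2)).
    by rewrite -!half //; ring.
  by rewrite !split //; ring.
rewrite !kernel_sumD !kernel_sumZ hp0 h0p (hswap 1 (p - 1)); last by ring.
rewrite !kE; last 2 first.
- by field.
- by field.
move: (kernel_sum (h (p - 1) 1)) (kernel_sum (h (p / 2) (p / 2))).
move=> K1 K2; rewrite !mulr0 addr0 add0r -mulr2n rmorphN rmorph_nat => ge0.
rewrite lerN2 -subr_ge0 -(pmulr_rge0 _ (ltr0n C 2)).
rewrite (_ : _ * _ = - io c * K1 *+ 2 + 2%:R * K2) //; ring.
Qed.

End ModularKernel.

(** * Traces as sums over a modular kernel *)

Section TraceExpansion.
Variables (C : numClosedFieldType) (n : nat) (L : {linear 'M[C]_n -> 'M[C]_n}).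
Variables (U V : 'M[C]_n).
Hypotheses (Uu : U \is unitarymx) (Vu : V \is unitarymx).

Definition basis_vec (a : 'I_n) : 'cV[C]_n := U^t* *m delta_mx a 0.

(** <u_i, L (|u_a><u_b|) u_j>, where the u_i are the columns of U^*. *)
Definition superop_coef i j a b : C :=
  (U *m L (basis_vec a *m (basis_vec b)^t*) *m U^t*) i j.

Lemma basis_vec_delta a b :
  basis_vec a *m (basis_vec b)^t* = U^t* *m delta_mx a b *m U.
Proof.
rewrite /basis_vec trmx_mul map_mxM /= trmxCK trmx_delta map_delta_mx.
by rewrite mulmxA -(mulmxA _ (delta_mx a 0)) mul_delta_mx.
Qed.

Lemma superop_conj_sum (N : 'M[C]_n) i j :
  (U *m L (U^t* *m N *m U) *m U^t*) i j = \sum_a \sum_b N a b * superop_coef i j a b.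
Proof.
rewrite {1}(matrix_sum_delta N) mulmx_sumr mulmx_suml linear_sum /= mulmx_sumr mulmx_suml.
rewrite summxE; apply: eq_bigr => a _.
rewrite mulmx_sumr mulmx_suml linear_sum /= mulmx_sumr mulmx_suml.
rewrite summxE; apply: eq_bigr => b _.
rewrite -scalemxAr -scalemxAl linearZ /= -scalemxAr -scalemxAl.
by rewrite -basis_vec_delta mxE.
Qed.

Lemma mxtrace_conj_mul (N Y : 'M[C]_n) :
  \tr (U^t* *m N *m U *m Y) = \sum_i \sum_j N j i * (U *m Y *m U^t*) i j.
Proof.
rewrite -!mulmxA mxtrace_mulC -!mulmxA [U *m (Y *m _)]mulmxA.
rewrite /mxtrace exchange_big /=; apply: eq_bigr => j _.
by rewrite mxE.
Qed.

Lemma sandwich_entry W (d f : 'rV[C]_n) : W = U *m V^t* ->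
  unitary_diag U d *m unitary_diag V f *m unitary_diag U d =
  U^t* *m (\matrix_(a, b) \sum_l (d 0 a * d 0 b) * (W a l * f 0 l * (W b l)^*)) *m U.
Proof.
move=> WE; rewrite /unitary_diag !mulmxA -!mulmxA; congr (_ *m _); rewrite !mulmxA; congr (_ *m _).
have -> : diag_mx d *m U *m V^t* *m diag_mx f *m V *m U^t* *m diag_mx d =
   diag_mx d *m (W *m diag_mx f *m W^t*) *m diag_mx d.
  by rewrite WE trmx_mul map_mxM /= trmxCK !mulmxA.
apply/matrixP => a b; rewrite mul_diag_mx mul_mx_diag !mxE.
rewrite mulr_sumr mulr_suml; apply: eq_bigr => l _.
by rewrite mul_mx_diag !mxE; ring.
Qed.

Lemma mxtrace_superop W (d e f g : 'rV[C]_n) : W = U *m V^t* ->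
  \tr (unitary_diag U d *m unitary_diag V g *m unitary_diag U d *m
       L (unitary_diag U e *m unitary_diag V f *m unitary_diag U e)) =
  \sum_(u : index6 n) (let: ((k, l), (i, a), (j, b)) := u in
     g 0 k * f 0 l * (d 0 i * d 0 j * (e 0 a * e 0 b))) * weight superop_coef W u.
Proof.
move=> WE; rewrite !(sandwich_entry _ _ WE) mxtrace_conj_mul sum_index6.
transitivity (\sum_i \sum_j \sum_k \sum_a \sum_b \sum_l
    (g 0 k * f 0 l * (d 0 i * d 0 j * (e 0 a * e 0 b))) *
    weight superop_coef W (k, l, (i, a), (j, b))).
  apply: eq_bigr => i _; apply: eq_bigr => j _; rewrite superop_conj_sum mxE mulr_suml.
  apply: eq_bigr => k _; rewrite mulr_sumr; apply: eq_bigr => a _; rewrite mulr_sumr.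
  apply: eq_bigr => b _; rewrite mxE mulr_suml mulr_sumr; apply: eq_bigr => l _.
  by rewrite /weight; ring.
under eq_bigr => i _ do rewrite exchange_big /=.
rewrite exchange_big /=; apply: eq_bigr => k _.
under [RHS]eq_bigr => l _ do under eq_bigr => i _ do rewrite exchange_big /=.
rewrite [RHS]exchange_big /=; apply: eq_bigr => i _.
rewrite [RHS]exchange_big /=; apply: eq_bigr => j _.
rewrite [RHS]exchange_big /=; apply: eq_bigr => a _.
by rewrite exchange_big.
Qed.

End TraceExpansion.

(** * Functional calculus and the maps Gam *)

HB.lock Definition spec_mx (R : realType) (n : nat) (V : 'M[R[i]%C]_n) (d : 'I_n -> R) :
  'M[R[i]%C]_n := unitary_diag V (\row_i (d i)%:C%C).

Section RealSpectrum.
Variables (R : realType) (n : nat).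
Local Notation C := R[i]%C.
Local Notation M := 'M[C]_n.
Implicit Types (V : M) (d e : 'I_n -> R).

Lemma spec_mxE V d : spec_mx V d = unitary_diag V (\row_i (d i)%:C%C).
Proof. by rewrite spec_mx.unlock. Qed.

Lemma eq_spec_mx V d e : d =1 e -> spec_mx V d = spec_mx V e.
Proof.
move=> de; rewrite !spec_mxE; apply: (congr1 (unitary_diag V)).
by apply/rowP => i; rewrite !mxE de.
Qed.

Lemma spec_mxM V d e : V \is unitarymx ->
  spec_mx V d *m spec_mx V e = spec_mx V (fun i => d i * e i).
Proof.
move=> Vu; rewrite !spec_mxE (unitary_diagM _ _ Vu); apply: (congr1 (unitary_diag V)).
by apply/rowP => i; rewrite !mxE; exact: (esym (rmorphM (real_complex R) _ _)).
Qed.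

Lemma spec_mx1 V : V \is unitarymx -> spec_mx V (fun=> 1) = 1%:M.
Proof.
move=> Vu; rewrite spec_mxE /unitary_diag.
have -> : diag_mx (\row_(_ < n) 1%:C%C) = 1%:M :> M.
  by rewrite -diag_const_mx; congr diag_mx; apply/rowP => i; rewrite !mxE.
by rewrite mulmx1 unitary_mulCV.
Qed.

Lemma spec_mxC V d : (spec_mx V d)^t* = spec_mx V d.
Proof.
rewrite spec_mxE; apply: unitary_diagC; apply/mxOverP => i j; rewrite mxE.
by apply/complex_realP; exists (d j).
Qed.

Lemma spec_mx_tr V d : V \is unitarymx -> \tr (spec_mx V d) = (\sum_i d i)%:C%C.
Proof.
move=> Vu; rewrite spec_mxE unitary_diag_tr // (raddf_sum (real_complex R)) /=.
by apply: eq_bigr => i _; rewrite mxE.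
Qed.

Lemma mxpowR_spec V d (t : R) : V \is unitarymx ->
  mxpowR (spec_mx V d) t = spec_mx V (fun i => d i `^ t).
Proof.
move=> Vu; rewrite !spec_mxE /mxpowR /mxfun.
apply: etrans (spectral_map_unitary_diag (\row_i (d i)%:C%C)
  (fun z : C => ((complex.Re z) `^ t)%:C%C) Vu) _.
by apply: (congr1 (unitary_diag V)); apply/rowP => i; rewrite !mxE.
Qed.

Lemma mxabs_spec V d : V \is unitarymx -> (forall i, 0 <= d i) ->
  mxabs (spec_mx V d) = spec_mx V d.
Proof.
move=> Vu d0; rewrite /mxabs spec_mxC (spec_mxM _ _ Vu) (mxpowR_spec _ _ Vu).
apply: eq_spec_mx => i.
by rewrite -expr2 -(powR_mulrn _ (d0 i)) -powRrM divff ?powRr1 // pnatr_eq0.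
Qed.

Lemma spec_mx_psd V d : (forall i, 0 <= d i) -> psdmx (spec_mx V d).
Proof. by move=> d0; rewrite spec_mxE; apply: unitary_diag_form_ge0 => i; rewrite mxE ler0c. Qed.

Lemma spec_mx_unit V d : V \is unitarymx -> (forall i, 0 < d i) -> spec_mx V d \in unitmx.
Proof.
move=> Vu d0; suff H : spec_mx V d *m spec_mx V (fun i => (d i)^-1) = 1%:M.
  by have [H1 _] := mulmx1_unit H.
by rewrite (spec_mxM _ _ Vu) -(spec_mx1 Vu); apply: eq_spec_mx => i; rewrite divff ?gt_eqF.
Qed.

Lemma psdmx_spec (A : M) : psdmx A ->
  exists V d, [/\ V \is unitarymx, forall i, 0 <= d i & A = spec_mx V d].
Proof.
move=> /form_ge0_unitary_diag[V [d [Vu d0 AE]]].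
exists V, (fun i => complex.Re (d 0 i)); split => //.
  by move=> i; have := d0 i; rewrite lecE => /andP[_].
rewrite AE spec_mxE; apply: (congr1 (unitary_diag V)); apply/rowP => i.
by rewrite mxE RRe_real // ger0_real.
Qed.

Lemma psdmx_unit_spec (A : M) : psdmx A -> A \in unitmx ->
  exists V d, [/\ V \is unitarymx, forall i, 0 < d i & A = spec_mx V d].
Proof.
move=> /psdmx_spec[V [d [Vu d0 AE]]] Au; exists V, d; split => // i.
rewrite lt0r d0 andbT; rewrite AE spec_mxE in Au.
have := unitary_diag_unit i Vu Au; rewrite mxE.
by apply: contra_neq => ->.
Qed.

Lemma pdmx_spec (A : M) : pdmx A ->
  exists V d, [/\ V \is unitarymx, forall i, 0 < d i & A = spec_mx V d].
Proof.
move=> pA; have psdA : psdmx A.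
  by move=> v; have [->|/pA/ltW//] := eqVneq v 0; rewrite mulmx0 mxE.
have [V [d [Vu d0 AE]]] := psdmx_spec psdA.
exists V, d; split=> // i.
have := pA _ (row_unitary_neq0 i Vu); rewrite trmxCK AE spec_mxE unitary_diag_form // mxE.
by rewrite ltcR.
Qed.

Lemma pdmx_congr (A B : M) : pdmx A -> B \in unitmx -> pdmx (B^t* *m A *m B).
Proof. exact: form_gt0_congr. Qed.

End RealSpectrum.

Lemma ip_half_Gam (R : realType) n (sigma X Y : 'M[R[i]%C]_n) : X^t* = X ->
  ip_half sigma X Y = \tr (Gam sigma 1 X *m Y).
Proof. by move=> XC; rewrite /ip_half XC /Gam div1r. Qed.

Section GamAlgebra.
Variables (R : realType) (n : nat).
Local Notation C := R[i]%C.
Local Notation M := 'M[C]_n.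
Variables (U : M) (s : 'I_n -> R).
Hypotheses (Uu : U \is unitarymx) (s_gt0 : forall i, 0 < s i).
Local Notation sigma := (spec_mx U s).

Lemma GamE r (X : M) : Gam sigma r X =
  spec_mx U (fun i => s i `^ (r / 2)) *m X *m spec_mx U (fun i => s i `^ (r / 2)).
Proof. by rewrite /Gam (mxpowR_spec _ _ Uu). Qed.

Lemma GamD r t (X : M) : Gam sigma r (Gam sigma t X) = Gam sigma (r + t) X.
Proof.
have powD u v i : s i `^ (u / 2) * s i `^ (v / 2) = s i `^ ((u + v) / 2).
  by rewrite mulrDl powRD //; apply/implyP => _; rewrite gt_eqF.
pose d u i := s i `^ (u / 2).
rewrite !GamE (_ : _ *m _ *m _ =
  (spec_mx U (d r) *m spec_mx U (d t)) *m X *m (spec_mx U (d t) *m spec_mx U (d r))).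
  rewrite (spec_mxM (d r) (d t) Uu) (spec_mxM (d t) (d r) Uu).
  have -> : spec_mx U (fun i => d r i * d t i) = spec_mx U (d (r + t)).
    by apply: eq_spec_mx => i; rewrite /d powD.
  have -> // : spec_mx U (fun i => d t i * d r i) = spec_mx U (d (r + t)).
  by apply: eq_spec_mx => i; rewrite /d powD addrC.
by rewrite !mulmxA.
Qed.

Lemma Gam0 (X : M) : Gam sigma 0 X = X.
Proof.
have s0 : spec_mx U (fun i => s i `^ (0 / 2)) = 1%:M.
  by rewrite -(spec_mx1 Uu); apply: eq_spec_mx => i; rewrite mul0r powRr0.
by rewrite GamE s0 mul1mx mulmx1.
Qed.

Lemma GamC r (X : M) : X^t* = X -> (Gam sigma r X)^t* = Gam sigma r X.
Proof.
move=> XC; by rewrite GamE !trmx_mul !map_mxM /= XC !spec_mxC mulmxA.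
Qed.

Lemma Gam_pd r (X : M) : pdmx X -> pdmx (Gam sigma r X).
Proof.
move=> pX; rewrite GamE; set S := spec_mx _ _.
have -> : S *m X *m S = S^t* *m X *m S by rewrite [S^t*]spec_mxC.
by apply: pdmx_congr => //; apply: spec_mx_unit => // i; exact: powR_gt0.
Qed.

Lemma Gam_psd r (X : M) : psdmx X -> psdmx (Gam sigma r X).
Proof.
move=> pX v; rewrite GamE; set S := spec_mx _ _.
have -> : v^t* *m (S *m X *m S) *m v = (S *m v)^t* *m X *m (S *m v).
  by rewrite trmx_mul map_mxM /= [S^t*]spec_mxC !mulmxA.
exact: pX.
Qed.

End GamAlgebra.

(** * The modular kernel of a generator *)

Lemma form_conj (C : numClosedFieldType) n (A : 'M[C]_n) (u v : 'cV[C]_n) :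
  ((u^t* *m A *m v) 0 0)^* = (v^t* *m A^t* *m u) 0 0.
Proof. by rewrite -adjmxE !trmx_mul !map_mxM /= trmxCK mulmxA. Qed.

Section BasisVectors.
Variables (C : numClosedFieldType) (n : nat) (U : 'M[C]_n).
Hypothesis Uu : U \is unitarymx.
Local Notation x := (basis_vec U).

Lemma superop_coefE (L : {linear 'M[C]_n -> 'M[C]_n}) i j a b :
  superop_coef L U i j a b = ((x i)^t* *m L (x a *m (x b)^t*) *m x j) 0 0.
Proof.
rewrite /superop_coef; set Z := L _.
rewrite /basis_vec trmx_mul map_mxM /= trmxCK trmx_delta map_delta_mx.
by rewrite -!mulmxA !(mulmxA _ _ (delta_mx j 0)) -colE -rowE !mxE.
Qed.

Lemma basis_vec_sum : \sum_a x a *m (x a)^t* = 1%:M.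
Proof.
under eq_bigr => a _ do rewrite basis_vec_delta.
by rewrite -mulmx_suml -mulmx_sumr -mx1_sum_delta mulmx1 unitary_mulCV.
Qed.

Lemma basis_vec_eigenr d k : unitary_diag U d *m x k = d 0 k *: x k.
Proof.
rewrite /unitary_diag /basis_vec -!mulmxA (mulmxA U) (unitarymxP Uu) mul1mx.
rewrite (_ : diag_mx d *m _ = d 0 k *: delta_mx k 0) ?scalemxAr //.
apply/matrixP => i j; rewrite mul_diag_mx !mxE.
by have [->//|_] := eqVneq i k; rewrite !mulr0.
Qed.

Lemma basis_vec_eigenl d k : (x k)^t* *m unitary_diag U d = d 0 k *: (x k)^t*.
Proof.
rewrite /unitary_diag /basis_vec trmx_mul map_mxM /= trmxCK trmx_delta map_delta_mx.
by rewrite !mulmxA -(mulmxA _ U) (unitarymxP Uu) mulmx1 -rowE row_diag_mx -scalemxAl.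
Qed.

Lemma mxtrace_diag_rank1 d (Z : 'M[C]_n) i j :
  \tr (unitary_diag U d *m Z *m (x j *m (x i)^t*)) = d 0 i * ((x i)^t* *m Z *m x j) 0 0.
Proof.
have [y ->] : {y | x j = y} by exists (x j).
rewrite mulmxA mxtrace_mulC -(mulmxA (unitary_diag U d)) (mulmxA _ (unitary_diag U d)).
rewrite basis_vec_eigenl -scalemxAl mxtraceZ mulmxA.
by rewrite /mxtrace big_ord1.
Qed.

Lemma mxtrace_rank1_diag d (Z : 'M[C]_n) a b :
  \tr (unitary_diag U d *m (x a *m (x b)^t*) *m Z) = d 0 a * ((x b)^t* *m Z *m x a) 0 0.
Proof.
rewrite (mulmxA _ (x a)) basis_vec_eigenr.
have [y ->] : {y | x a = y} by exists (x a).
have [y' ->] : {y | x b = y} by exists (x b).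
rewrite -!scalemxAl mxtraceZ -!mulmxA mxtrace_mulC.
by rewrite /mxtrace big_ord1 !mulmxA.
Qed.

Lemma superop_coef_form (L : {linear 'M[C]_n -> 'M[C]_n}) (u v : 'cV[C]_n) a b :
  ((U^t* *m u)^t* *m L (x a *m (x b)^t*) *m (U^t* *m v)) 0 0 =
  \sum_i \sum_j (u i 0)^* * superop_coef L U i j a b * v j 0.
Proof.
rewrite /superop_coef; set Z := L _.
rewrite trmx_mul map_mxM /= trmxCK.
have -> : u^t* *m U *m Z *m (U^t* *m v) = u^t* *m (U *m Z *m U^t*) *m v by rewrite !mulmxA.
have [Z' ->] : {Z' | U *m Z *m U^t* = Z'} by exists (U *m Z *m U^t*).
rewrite mxE [RHS]exchange_big /=; apply: eq_bigr => j _.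
by rewrite mxE mulr_suml; apply: eq_bigr => i _; rewrite adjmxE.
Qed.

Lemma basis_vec_dot (u : 'cV[C]_n) a : ((U^t* *m u)^t* *m x a) 0 0 = (u a 0)^*.
Proof.
by rewrite trmx_mul map_mxM /= trmxCK /basis_vec !mulmxA unitary_mulKV // -colE !mxE.
Qed.

End BasisVectors.

Section GeneratorCoef.
Variables (R : realType) (n : nat).
Local Notation C := R[i]%C.
Local Notation M := 'M[C]_n.
Variables (P : R -> {linear M -> M}) (L : {linear M -> M}).
Hypotheses (qmsP : QMS P) (genL : is_generator P L).
Variables (U : M) (s : 'I_n -> R).
Hypotheses (Uu : U \is unitarymx).
Hypothesis gns : GNS_detailed_balance (spec_mx U s) L.
Local Notation ell := (superop_coef L U).
Local Notation x := (basis_vec U).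

Lemma generator_coef_conj i j a b : (ell i j a b)^* = ell j i b a.
Proof.
by rewrite superop_coefE superop_coefE form_conj (generator_conj qmsP genL x a b).
Qed.

Lemma generator_coef_one i j : \sum_a ell i j a a = 0.
Proof.
rewrite /superop_coef -summxE -mulmx_suml -mulmx_sumr -linear_sum.
by rewrite (basis_vec_sum Uu) (generator_one qmsP genL) mulmx0 mul0mx mxE.
Qed.

Lemma generator_coef_gns i j a b :
  (s i)%:C%C * ell i j a b = (s a)%:C%C * ell b a j i.
Proof.
have := gns (x b *m (x a)^t*) (x j *m (x i)^t*).
rewrite /ip_one (generator_conj qmsP genL x b a).
have -> : (x b *m (x a)^t*)^t* = x a *m (x b)^t* by rewrite trmx_mul map_mxM /= trmxCK.
have sE k : (\row_i (s i)%:C%C : 'rV[C]_n) 0 k = (s k)%:C%C by rewrite mxE.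
rewrite spec_mxE (mxtrace_diag_rank1 Uu) (mxtrace_rank1_diag Uu) !sE => H.
by rewrite (superop_coefE U L i j a b) (superop_coefE U L b a j i).
Qed.

Lemma generator_coef_pos (z : 'I_n -> 'I_n -> C) : \sum_a z a a = 0 ->
  0 <= \sum_a \sum_b \sum_i \sum_j (z i a)^* * ell i j a b * z j b.
Proof.
move=> z0; pose w a : 'cV[C]_n := U^t* *m (\col_i z i a).
have w0 : \sum_a ((w a)^t* *m x a) 0 0 = 0.
  transitivity ((\sum_a z a a)^* : C); last by rewrite z0 conjC0.
  rewrite rmorph_sum; apply: eq_bigr => a _.
  by rewrite (basis_vec_dot Uu) mxE.
have <- : choi_form L x w =
    \sum_a \sum_b \sum_i \sum_j (z i a)^* * ell i j a b * z j b; last first.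
  exact: (generator_choi_form_ge0 qmsP genL w0).
rewrite /choi_form; apply: eq_bigr => a _; apply: eq_bigr => b _.
rewrite superop_coef_form; apply: eq_bigr => i _; apply: eq_bigr => j _.
by rewrite !mxE.
Qed.

End GeneratorCoef.

(** * The Stroock-Varopoulos inequality *)

Section StroockVaropoulos.
Variables (R : realType) (n : nat).
Local Notation C := R[i]%C.
Local Notation M := 'M[C]_n.
Variables (P : R -> {linear M -> M}) (L : {linear M -> M}).
Variables (U V : M) (s a : 'I_n -> R).
Hypotheses (Uu : U \is unitarymx) (Vu : V \is unitarymx).
Hypotheses (s_gt0 : forall i, 0 < s i) (a_gt0 : forall k, 0 < a k).
Local Notation sigma := (spec_mx U s).
Local Notation W := (U *m V^t*).

Lemma mxtrace_Gam_superop r al be :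
  \tr (Gam sigma r (spec_mx V (fun k => a k `^ al)) *m
       L (Gam sigma (- r) (spec_mx V (fun l => a l `^ be)))) =
  kernel_sum (real_complex R) (superop_coef L U) W (power_kernel s a (r / 2) al be).
Proof.
rewrite !(GamE _ Uu) !spec_mxE (mxtrace_superop L _ _ _ _ (erefl W)).
apply: eq_bigr => -[[[k l] [i i']] [j j']] _; congr (_ * _).
by rewrite !mxE /power_kernel mulNr !(rmorphM (real_complex R)).
Qed.

(** Both energies are traces Tr (Gam r (A ^ al) L (Gam (-r) (A ^ be))), with
    r = 1/2 and al = be = p/2 for the left side, and with r = 1/p, al = p - 1
    and be = 1 for the right side. *)
Lemma stroock_varopoulos (X : M) p : QMS P -> is_generator P L ->
  GNS_detailed_balance sigma L -> 1 < p <= 2 -> Gam sigma p^-1 X = spec_mx V a ->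
  dirichlet2 sigma L (Gam sigma (- 2^-1) (spec_mx V (fun k => a k `^ (p / 2))))
  <= dirichlet p sigma L X.
Proof.
move=> qmsP genL gns p12 AE; have /andP[p1 p2] := p12.
have p0 : p != 0 by rewrite gt_eqF // (lt_trans _ p1).
have p10 : p - 1 != 0 by rewrite gt_eqF // subr_gt0.
have Wu : W \is unitarymx by exact: unitary_mul_adj.
have XE : X = Gam sigma (- p^-1) (spec_mx V (fun k => a k `^ 1)).
  have <- : spec_mx V a = spec_mx V (fun k => a k `^ 1).
    by apply: eq_spec_mx => k; rewrite powRr1 // ltW.
  by rewrite -AE (GamD Uu s_gt0) addNr (Gam0 _ Uu).
rewrite /dirichlet2 ip_half_Gam ?(GamD Uu s_gt0); last first.
  by apply: (GamC _ Uu); exact: spec_mxC.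
rewrite /dirichlet AE (mxpowR_spec _ _ Vu) ip_half_Gam; last first.
  by apply: (GamC _ Uu); exact: spec_mxC.
rewrite (GamD Uu s_gt0) XE.
have -> : 1 + - 2^-1 = 2^-1 :> R by field.
have -> : 1 + - (conj_exp p)^-1 = p^-1 by rewrite /conj_exp; field; rewrite p0.
have reduce (t1 t2 k1 k2 c : C) : t1 = k1 -> t2 = k2 ->
  - k1 <= - (c * k2) -> - t1 <= - c * t2 by move=> -> ->; rewrite mulNr.
apply: (reduce _ _ _ _ _ (mxtrace_Gam_superop 2^-1 (p / 2) (p / 2))
  (mxtrace_Gam_superop p^-1 (p - 1) 1)).
have -> : conj_exp p * p / 4 = p ^+ 2 / (4 * (p - 1)) by rewrite /conj_exp; field.
have -> : (2^-1 / 2 : R) = 4^-1 by field.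
have -> : p^-1 / 2 = (2 * p)^-1 by field.
apply: stroock_varopoulos_kernel => //.
- by move=> x; rewrite ler0c.
- exact: (generator_coef_conj qmsP genL).
- exact: (generator_coef_gns qmsP genL Uu gns).
- exact: (generator_coef_one qmsP genL Uu).
- exact: (generator_coef_pos qmsP genL Uu).
Qed.

End StroockVaropoulos.

(** * A Lieb-Thirring inequality *)

Section UnitarySums.
Variables (C : numClosedFieldType) (n : nat).
Implicit Types (U V T E F : 'M[C]_n) (d f : 'rV[C]_n).

Lemma row_norm_sum E d F k : F \is unitarymx ->
  \sum_m (E *m diag_mx d *m F) k m * ((E *m diag_mx d *m F) k m)^* =
  \sum_i (d 0 i * (d 0 i)^*) * (E k i * (E k i)^*).
Proof.
move=> Fu; transitivity (((E *m diag_mx d *m F) *m (E *m diag_mx d *m F)^t*) k k).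
  by rewrite [RHS]mxE; apply: eq_bigr => m _; rewrite adjmxE.
rewrite trmx_mul map_mxM /= mulmxA (unitary_mulKV _ Fu) mxE.
by apply: eq_bigr => i _; rewrite adjmxE mul_mx_diag !mxE rmorphM; ring.
Qed.

Lemma col_norm_sum E d F (c : 'rV[C]_n) m :
  \sum_k c 0 k * ((E *m diag_mx d *m F) k m * ((E *m diag_mx d *m F) k m)^*) =
  (F^t* *m (diag_mx d)^t* *m E^t* *m diag_mx c *m E *m diag_mx d *m F) m m.
Proof.
set M := E *m diag_mx d *m F.
have -> : F^t* *m (diag_mx d)^t* *m E^t* *m diag_mx c *m E *m diag_mx d *m F =
   M^t* *m diag_mx c *m M.
  by rewrite /M !trmx_mul !map_mxM /= !mulmxA.
have [M' ->] : {M' | M = M'} by exists M.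
rewrite mxE; apply: eq_bigr => k _.
by rewrite mul_mx_diag mxE adjmxE; ring.
Qed.

Lemma col_norm_sum1 E d F m : E \is unitarymx ->
  \sum_k (E *m diag_mx d *m F) k m * ((E *m diag_mx d *m F) k m)^* =
  \sum_i (d 0 i * (d 0 i)^*) * (F i m * (F i m)^*).
Proof.
move=> Eu; pose one : 'rV[C]_n := const_mx 1.
transitivity (\sum_k one 0 k * ((E *m diag_mx d *m F) k m * ((E *m diag_mx d *m F) k m)^*)).
  by apply: eq_bigr => k _; rewrite [one 0 k]mxE mul1r.
rewrite col_norm_sum diag_const_mx mulmx1 mulmxKtV //.
rewrite tr_diag_mx map_diag_mx mxE; apply: eq_bigr => i _.
by rewrite !mul_mx_diag !mxE; ring.
Qed.

(** The left side is the (m, m) entry of T (B C B) T^*, where B and C have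
    eigenvalues b and c. *)
Lemma sandwich_eigen U V T (b c mu : 'rV[C]_n) m : T \is unitarymx -> b \is a realmx ->
  unitary_diag U b *m unitary_diag V c *m unitary_diag U b = unitary_diag T mu ->
  \sum_k c 0 k * (((V *m U^t*) *m diag_mx b *m (U *m T^t*)) k m *
    (((V *m U^t*) *m diag_mx b *m (U *m T^t*)) k m)^*) = mu 0 m.
Proof.
move=> Tu bR NE; rewrite col_norm_sum.
have -> : (diag_mx b)^t* = diag_mx b by rewrite tr_diag_mx map_diag_mx realmxC.
have -> : (U *m T^t*)^t* = T *m U^t* by rewrite trmx_mul map_mxM /= trmxCK.
have -> : (V *m U^t*)^t* = U *m V^t* by rewrite trmx_mul map_mxM /= trmxCK.
transitivity ((T *m (unitary_diag U b *m unitary_diag V c *m unitary_diag U b) *m T^t*) m m).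
  by rewrite /unitary_diag !mulmxA.
rewrite NE /unitary_diag !mulmxA (unitarymxP Tu) mul1mx (unitary_mulKV _ Tu).
by rewrite !mxE eqxx mulr1n.
Qed.

Lemma col_norm1 F m : F \is unitarymx -> \sum_i F i m * (F i m)^* = 1.
Proof.
move=> Fu; have /matrixP/(_ m m) := unitary_mulCV Fu; rewrite !mxE eqxx mulr1n => <-.
by apply: eq_bigr => i _; rewrite adjmxE mulrC.
Qed.

Lemma mxtrace_sandwich U V d f : U \is unitarymx -> V \is unitarymx ->
  \tr (unitary_diag U d *m unitary_diag V f *m unitary_diag U d) =
  \sum_k \sum_i (f 0 k * (d 0 i * d 0 i)) * ((V *m U^t*) k i * ((V *m U^t*) k i)^*).
Proof.
move=> Uu Vu; have [E EE] : {E | E = V *m U^t*} by exists (V *m U^t*).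
have EC : E^t* = U *m V^t* by rewrite EE trmx_mul map_mxM /= trmxCK.
transitivity (\tr (diag_mx d *m E^t* *m diag_mx f *m E *m diag_mx d)).
  by rewrite EC EE /unitary_diag !mulmxA mxtrace_mulC !mulmxA (unitarymxP Uu) mul1mx.
rewrite -EE /mxtrace exchange_big /=; apply: eq_bigr => i _.
rewrite mul_mx_diag mxE mxE mulr_suml; apply: eq_bigr => k _.
by rewrite mul_mx_diag mxE mul_diag_mx mxE adjmxE; ring.
Qed.

End UnitarySums.

Section LiebThirring.
Variables (R : realType) (n : nat).
Local Notation C := R[i]%C.
Local Notation M := 'M[C]_n.

Definition sqnorm (z : C) : R := complex.Re z ^+ 2 + complex.Im z ^+ 2.

Lemma sqnormE (z : C) : (sqnorm z)%:C%C = z * z^*.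
Proof. by rewrite /sqnorm (add_Re2_Im2 z) normCK. Qed.

Lemma sqnorm_ge0 z : 0 <= sqnorm z.
Proof. by rewrite addr_ge0 ?sqr_ge0. Qed.

(** The gap, times A + B, is |A u - B v|^2. *)
Lemma sqnorm_parallel (A B : R) (u v : C) : 0 < A -> 0 < B ->
  A * B / (A + B) * sqnorm (u + v) <= A * sqnorm u + B * sqnorm v.
Proof.
move=> A0 B0; case: u => u1 u2; case: v => v1 v2; rewrite /sqnorm /=.
have AB : 0 < A + B by rewrite addr_gt0.
rewrite mulrAC ler_pdivrMr // -subr_ge0.
have -> : (A * (u1 ^+ 2 + u2 ^+ 2) + B * (v1 ^+ 2 + v2 ^+ 2)) * (A + B) -
   A * B * ((u1 + v1) ^+ 2 + (u2 + v2) ^+ 2) =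
   (A * u1 - B * v1) ^+ 2 + (A * u2 - B * v2) ^+ 2 by ring.
by rewrite addr_ge0 ?sqr_ge0.
Qed.

Definition rdiag (d : 'I_n -> R) : 'rV[C]_n := \row_i (d i)%:C%C.

Lemma rdiag_real d : rdiag d \is a realmx.
Proof.
by apply/mxOverP => i j; rewrite mxE; apply/complex_realP; exists (d j).
Qed.

Lemma sqnorm_row (E F : M) d k : F \is unitarymx ->
  \sum_m sqnorm ((E *m diag_mx (rdiag d) *m F) k m) = \sum_i d i ^+ 2 * sqnorm (E k i).
Proof.
move=> Fu; apply: (@complexI R); rewrite !(raddf_sum (real_complex R)).
under eq_bigr => m _ do rewrite /= sqnormE.
rewrite (row_norm_sum _ _ _ Fu); apply: eq_bigr => i _.
rewrite /= (rmorphM (real_complex R)) /= (rmorphXn (real_complex R)) /= sqnormE.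
congr (_ * _); rewrite mxE expr2; congr (_ * _).
by apply/CrealP; apply/complex_realP; exists (d i).
Qed.

Lemma sqnorm_col (E F : M) d m : E \is unitarymx ->
  \sum_k sqnorm ((E *m diag_mx (rdiag d) *m F) k m) = \sum_i d i ^+ 2 * sqnorm (F i m).
Proof.
move=> Eu; apply: (@complexI R); rewrite !(raddf_sum (real_complex R)).
under eq_bigr => k _ do rewrite /= sqnormE.
rewrite (col_norm_sum1 _ _ _ Eu); apply: eq_bigr => i _.
rewrite /= (rmorphM (real_complex R)) /= (rmorphXn (real_complex R)) /= sqnormE.
congr (_ * _); rewrite mxE expr2; congr (_ * _).
by apply/CrealP; apply/complex_realP; exists (d i).
Qed.

Lemma sqnorm_col1 (F : M) m : F \is unitarymx -> \sum_i sqnorm (F i m) = 1.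
Proof.
move=> Fu; apply: (@complexI R); rewrite (raddf_sum (real_complex R)) /=.
by rewrite -[RHS](col_norm1 m Fu); apply: eq_bigr => i _; rewrite sqnormE.
Qed.

Lemma mxtrace_spec_sandwich (U V : M) d f : U \is unitarymx -> V \is unitarymx ->
  \tr (spec_mx U d *m spec_mx V f *m spec_mx U d) =
  (\sum_k \sum_i (f k * d i ^+ 2) * sqnorm ((V *m U^t*) k i))%:C%C.
Proof.
move=> Uu Vu; rewrite !spec_mxE (mxtrace_sandwich _ _ Uu Vu).
rewrite (raddf_sum (real_complex R)); apply: eq_bigr => k _.
rewrite (raddf_sum (real_complex R)); apply: eq_bigr => i _ /=.
rewrite !(rmorphM (real_complex R)) /= sqnormE.
by rewrite !mxE.
Qed.

Lemma sqnorm_eigen (U V T : M) b c mu m : T \is unitarymx ->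
  spec_mx U b *m spec_mx V c *m spec_mx U b = spec_mx T mu ->
  \sum_k c k * sqnorm (((V *m U^t*) *m diag_mx (rdiag b) *m (U *m T^t*)) k m) = mu m.
Proof.
move=> Tu NE; apply: (@complexI R); rewrite (raddf_sum (real_complex R)).
transitivity (\sum_k rdiag c 0 k * (((V *m U^t*) *m diag_mx (rdiag b) *m (U *m T^t*)) k m *
   (((V *m U^t*) *m diag_mx (rdiag b) *m (U *m T^t*)) k m)^*)).
  apply: eq_bigr => k _; rewrite /= (rmorphM (real_complex R)) /= sqnormE.
  by rewrite [rdiag c 0 k]mxE.
by move: NE; rewrite !spec_mxE => /(sandwich_eigen m Tu (rdiag_real b)) ->; rewrite mxE.
Qed.

(** Let B, C, N = B C B have eigenvalues b_i, c_k, mu_m; let tau = (q - 1) / q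
    and be d k m = <v_k, d(B) t_m>. Apply [power_mean_le] to the sums over
    (k, m), (k, i) and (m, i), with t = mu_m ^ q / c_k ^ q and rho = b_i ^ (2 q).
    The conclusion reads (K1 + K2) S <= K1 Q + K2 S, where S and Q are the two
    sides of the claim: the sums over k of c_k |be b k m|^2 are the mu_m, and
    b_i ^ 2 rho ^ (tau-1) = 1. The hypothesis is the parallel sum inequality
    for the splitting b = f + g. *)
Lemma lieb_thirring (U V T : M) b c mu q : U \is unitarymx -> V \is unitarymx ->
  T \is unitarymx -> (forall i, 0 < b i) -> (forall k, 0 < c k) -> (forall m, 0 < mu m) ->
  1 < q -> spec_mx U b *m spec_mx V c *m spec_mx U b = spec_mx T mu ->
  \sum_m mu m `^ q <=
  \sum_k \sum_i (c k `^ q * (b i `^ q) ^+ 2) * sqnorm ((V *m U^t*) k i).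
Proof.
move=> Uu Vu Tu b0 c0 mu0 q1 NE.
have q0 : 0 < q by apply: lt_trans q1.
have qN0 : q != 0 by rewrite gt_eqF.
pose tau := (q - 1) / q.
have tau01 : 0 < tau < 1.
  by rewrite divr_gt0 ?subr_gt0 //= ltr_pdivrMr // mul1r ltrBlDr ltrDl.
have [E EE] : {E | E = V *m U^t*} by exists (V *m U^t*).
have [F FE] : {F | F = U *m T^t*} by exists (U *m T^t*).
have Eu : E \is unitarymx by rewrite EE; exact: unitary_mul_adj.
have Fu : F \is unitarymx by rewrite FE; exact: unitary_mul_adj.
pose be d := E *m diag_mx (rdiag d) *m F.
have beD d d' k m : be (fun i => d i + d' i) k m = be d k m + be d' k m.
  have -> : be (fun i => d i + d' i) = be d + be d'.
    rewrite /be -mulmxDl -mulmxDr; congr (_ *m _ *m _); apply/matrixP => i j.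
    by rewrite !mxE (rmorphD (real_complex R)) mulrnDl.
  by rewrite mxE.
pose s k := c k `^ q; pose z m := mu m `^ q; pose rho i := b i `^ (2 * q).
have s0 k : 0 < s k by apply: powR_gt0.
have z0 m : 0 < z m by apply: powR_gt0.
have rho0 i : 0 < rho i by apply: powR_gt0.
have powE x t : 0 < x -> x `^ t = expR (t * ln x) :> R by move=> x0; rewrite /powR gt_eqF.
have rho_pow i t : rho i `^ t = expR (t * (2 * q * ln (b i))).
  by rewrite powE // ln_powR.
have sqrE x : 0 < x -> x ^+ 2 = expR (ln x * 2) :> R.
  by move=> x0; rewrite expRM_natr lnK.
have [K1 [K2 [K1_gt0 H]]] := power_mean_le tau01.
have := H _ _ _
  (fun u : 'I_n * 'I_n => s u.1 * sqnorm (be b u.1 u.2)) (fun u => z u.2 / s u.1)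
  (fun u : 'I_n * 'I_n => s u.1 * b u.2 ^+ 2 * sqnorm (E u.1 u.2)) (fun u => rho u.2)
  (fun u : 'I_n * 'I_n => z u.1 * b u.2 ^+ 2 * sqnorm (F u.2 u.1)) (fun u => rho u.2).
have pairE (G : 'I_n -> 'I_n -> R) : \sum_(u : 'I_n * 'I_n) G u.1 u.2 = \sum_x \sum_y G x y.
  by rewrite pair_bigA.
rewrite (pairE (fun k m => s k * sqnorm (be b k m) * (z m / s k) `^ tau)).
rewrite (pairE (fun k i => s k * b i ^+ 2 * sqnorm (E k i) * rho i `^ tau)).
rewrite (pairE (fun m i => z m * b i ^+ 2 * sqnorm (F i m) * rho i `^ (tau - 1))).
have -> : \sum_k \sum_m s k * sqnorm (be b k m) * (z m / s k) `^ tau = \sum_m z m.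
  rewrite exchange_big /=; apply: eq_bigr => m _.
  transitivity (mu m `^ (q - 1) * \sum_k c k * sqnorm (be b k m)).
    rewrite mulr_sumr; apply: eq_bigr => k _.
    have -> : (z m / s k) `^ tau = mu m `^ (q - 1) * c k / s k.
      have lnz : ln (z m / s k) = q * ln (mu m) - q * ln (c k).
        by rewrite ln_div ?posrE // !ln_powR.
      rewrite -[c k in RHS]lnK ?posrE // !powE ?divr_gt0 // lnz /s powE // -expRN -!expRD.
      by congr expR; rewrite /tau; field.
    by field; rewrite gt_eqF.
  rewrite /be EE FE (sqnorm_eigen _ Tu NE).
  by rewrite /z -{2}[mu m]powRr1 ?ltW // -powRD ?subrK // gt_eqF // implybT.
have -> : \sum_k \sum_i s k * b i ^+ 2 * sqnorm (E k i) * rho i `^ tau =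
  \sum_k \sum_i (c k `^ q * (b i `^ q) ^+ 2) * sqnorm (E k i).
  apply: eq_bigr => k _; apply: eq_bigr => i _.
  have -> : (b i `^ q) ^+ 2 = b i ^+ 2 * rho i `^ tau.
    rewrite powE // rho_pow (sqrE (b i)) // -!expRM_natr -expRD.
    by congr expR; rewrite /tau; field.
  by rewrite /s; ring.
have -> : \sum_m \sum_i z m * b i ^+ 2 * sqnorm (F i m) * rho i `^ (tau - 1) = \sum_m z m.
  apply: eq_bigr => m _; rewrite -[RHS]mulr1 -[X in _ = _ * X](sqnorm_col1 m Fu) mulr_sumr.
  apply: eq_bigr => i _.
  have -> : rho i `^ (tau - 1) = b i ^- 2.
    by rewrite rho_pow sqrE // -expRN; congr expR; rewrite /tau; field.
  by field; rewrite gt_eqF.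
rewrite -EE; set S := \sum_m z m; set Q := \sum_k _ => H'.
suff : (K1 + K2) * S <= K1 * Q + K2 * S by rewrite mulrDl lerD2r ler_pM2l.
apply: H' => //.
- by move=> u; rewrite mulr_ge0 ?sqnorm_ge0 ?(ltW (s0 _)).
- by move=> u; rewrite divr_gt0.
- by move=> u; apply: mulr_ge0 (sqnorm_ge0 _); apply: mulr_ge0 (sqr_ge0 _); exact: ltW.
- by move=> u; apply: mulr_ge0 (sqnorm_ge0 _); apply: mulr_ge0 (sqr_ge0 _); exact: ltW.
move=> l l0.
rewrite (pairE (fun k m => s k * sqnorm (be b k m) * (l * (z m / s k) / (l + z m / s k)))).
rewrite (pairE (fun k i => s k * b i ^+ 2 * sqnorm (E k i) * (l * (rho i / (l + rho i)) ^+ 2))).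
rewrite (pairE (fun m i => z m * b i ^+ 2 * sqnorm (F i m) * (l / (l + rho i)) ^+ 2)).
pose f i := b i * (rho i / (l + rho i)); pose g i := b i * (l / (l + rho i)).
(* The optimal splitting of B when B, C and N commute. *)
have fg : b = (fun i => f i + g i).
  apply/funext => i; rewrite /f /g; field.
  by rewrite gt_eqF // addr_gt0.
have -> : \sum_k \sum_i s k * b i ^+ 2 * sqnorm (E k i) * (l * (rho i / (l + rho i)) ^+ 2) =
    \sum_k \sum_m l * s k * sqnorm (be f k m).
  apply: eq_bigr => k _; rewrite -mulr_sumr (sqnorm_row _ _ _ Fu) mulr_sumr.
  by apply: eq_bigr => i _; rewrite /f; ring.
have -> : \sum_m \sum_i z m * b i ^+ 2 * sqnorm (F i m) * (l / (l + rho i)) ^+ 2 =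
    \sum_k \sum_m z m * sqnorm (be g k m).
  rewrite [RHS]exchange_big /=.
  apply: eq_bigr => m _; rewrite -mulr_sumr (sqnorm_col _ _ _ Eu) mulr_sumr.
  by apply: eq_bigr => i _; rewrite /g; ring.
rewrite -big_split /=; apply: ler_sum => k _; rewrite -big_split /=; apply: ler_sum => m _.
have -> : be b k m = be f k m + be g k m by rewrite -beD -fg.
have ls : 0 < l * s k by rewrite mulr_gt0.
apply: le_trans (sqnorm_parallel _ _ ls (z0 m)).
rewrite le_eqVlt; apply/orP; left; apply/eqP; field.
by rewrite !gt_eqF // addr_gt0.
Qed.

End LiebThirring.

(** * Weighted norms and the Beckner inequalities *)

Section WeightedNorms.
Variables (R : realType) (n : nat).
Local Notation C := R[i]%C.
Local Notation M := 'M[C]_n.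

(** At q = 1 both sides are the trace of B C B. *)
Lemma lieb_thirring_ge1 (U V T : M) b c mu q : U \is unitarymx -> V \is unitarymx ->
  T \is unitarymx -> (forall i, 0 < b i) -> (forall k, 0 < c k) -> (forall m, 0 < mu m) ->
  1 <= q -> spec_mx U b *m spec_mx V c *m spec_mx U b = spec_mx T mu ->
  \sum_m mu m `^ q <=
  \sum_k \sum_i (c k `^ q * (b i `^ q) ^+ 2) * sqnorm ((V *m U^t*) k i).
Proof.
move=> Uu Vu Tu b0 c0 mu0; rewrite le_eqVlt => /orP[/eqP <- NE|q1 NE]; last first.
  exact: (lieb_thirring Uu Vu Tu b0 c0 mu0 q1 NE).
have := mxtrace_spec_sandwich b c Uu Vu; rewrite NE (spec_mx_tr _ Tu) => /(@complexI R) trE.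
rewrite le_eqVlt; apply/orP; left; apply/eqP.
under eq_bigr => m _ do rewrite powRr1 ?ltW //.
rewrite trE; apply: eq_bigr => k _; apply: eq_bigr => i _.
by rewrite !powRr1 ?ltW.
Qed.

Lemma wnorm_spec (sigma V X : M) a p : V \is unitarymx -> (forall k, 0 <= a k) ->
  Gam sigma p^-1 X = spec_mx V a -> wnorm sigma p X = (\sum_k a k `^ p) `^ p^-1.
Proof.
move=> Vu a0 XE; rewrite /wnorm XE (mxabs_spec Vu a0) (mxpowR_spec _ _ Vu).
by rewrite (spec_mx_tr _ Vu).
Qed.

Lemma wnorm_ge0 (sigma X : M) p : 0 <= wnorm sigma p X.
Proof. exact: powR_ge0. Qed.

Lemma wnorm_spec_powR (sigma V X : M) a p : V \is unitarymx -> (forall k, 0 <= a k) -> p != 0 ->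
  Gam sigma p^-1 X = spec_mx V a -> wnorm sigma p X `^ p = \sum_k a k `^ p.
Proof.
move=> Vu a0 p0 XE; rewrite (wnorm_spec Vu a0 XE) -powRrM mulVf // powRr1 //.
by apply: sumr_ge0 => k _; exact: powR_ge0.
Qed.

Variables (U V : M) (s a : 'I_n -> R) (p : R) (X : M).
Hypotheses (Uu : U \is unitarymx) (Vu : V \is unitarymx).
Hypotheses (s_gt0 : forall i, 0 < s i) (a_gt0 : forall k, 0 < a k).
Local Notation sigma := (spec_mx U s).
Hypotheses (p12 : 1 < p <= 2) (AE : Gam sigma p^-1 X = spec_mx V a) (pdX : pdmx X).
Let Y := Gam sigma (- 2^-1) (spec_mx V (fun k => a k `^ (p / 2))).

Lemma wnorm2_power : wnorm sigma 2 Y ^+ 2 = wnorm sigma p X `^ p.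
Proof.
have /andP[p1 _] := p12; have p0 : p != 0 by rewrite gt_eqF // (lt_trans _ p1).
have YE : Gam sigma 2^-1 Y = spec_mx V (fun k => a k `^ (p / 2)).
  by rewrite /Y (GamD Uu s_gt0) subrr (Gam0 _ Uu).
have two0 : 2 != 0 :> R by rewrite pnatr_eq0.
have Y2 := wnorm_spec_powR Vu (fun k => powR_ge0 (a k) (p / 2)) two0 YE.
have Xp := wnorm_spec_powR Vu (fun k => ltW (a_gt0 k)) p0 AE.
apply: etrans (esym (powR_mulrn 2 (wnorm_ge0 _ _ _))) _.
apply: etrans Y2 _; apply: etrans _ (esym Xp).
by apply: eq_bigr => k _; rewrite -powRrM divfK.
Qed.

Lemma Gam_spec_unit r d : (forall k, 0 < d k) -> Gam sigma r (spec_mx V d) \in unitmx.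
Proof.
move=> d0; have Su : spec_mx U (fun i => s i `^ (r / 2)) \in unitmx.
  by apply: spec_mx_unit => // i; exact: powR_gt0.
by rewrite (GamE _ Uu) !unitmx_mul Su (spec_mx_unit Vu d0).
Qed.

(** Both norms are computed from A: the left one is the power p of
    Tr (B C B) ^ q, with B a power of sigma and C = A ^ (p/2), and the right one
    is the power p of Tr (B ^ q C ^ q B ^ q), since C ^ q = A. *)
Lemma wnormq_power : wnorm sigma (2 / p) Y ^+ 2 <= wnorm sigma 1 X `^ p.
Proof.
have /andP[p1 p2] := p12; have p_gt0 : 0 < p by apply: lt_trans p1.
have p0 : p != 0 by rewrite gt_eqF.
have q1 : 1 <= 2 / p by rewrite ler_pdivlMr // mul1r.
have q0 : 2 / p != 0 by rewrite gt_eqF // divr_gt0.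
have [T [mu [Tu mu0 ZE]]] : exists T mu, [/\ T \is unitarymx, forall i, 0 < mu i &
    Gam sigma (2 / p)^-1 Y = spec_mx T mu].
  apply: psdmx_unit_spec; rewrite /Y (GamD Uu s_gt0).
    by apply: (Gam_psd _ Uu); apply: spec_mx_psd => k; exact: powR_ge0.
  by apply: Gam_spec_unit => k; exact: powR_gt0.
have [T' [nu [Tu' nu0 XE]]] : exists T mu, [/\ T \is unitarymx, forall i, 0 < mu i &
    Gam sigma 1^-1 X = spec_mx T mu].
  by apply: pdmx_spec; apply: (Gam_pd Uu s_gt0).
rewrite (wnorm_spec Tu _ ZE); last by move=> k; exact: ltW.
rewrite (wnorm_spec Tu' _ XE); last by move=> k; exact: ltW.
rewrite invr1 powRr1; last by apply: sumr_ge0 => k _; exact: powR_ge0.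
rewrite -powR_mulrn ?powR_ge0 // -powRrM.
have -> : (2 / p)^-1 * 2%:R = p by field.
apply: ge0_ler_powR; rewrite ?nnegrE.
- exact: ltW.
- by apply: sumr_ge0 => k _; exact: powR_ge0.
- by apply: sumr_ge0 => k _; exact: powR_ge0.
have sw : spec_mx U (fun i => s i `^ (((2 / p)^-1 - 2^-1) / 2)) *m
    spec_mx V (fun k => a k `^ (p / 2)) *m
    spec_mx U (fun i => s i `^ (((2 / p)^-1 - 2^-1) / 2)) = spec_mx T mu.
  by rewrite -ZE /Y (GamD Uu s_gt0) (GamE _ Uu).
apply: le_trans (lieb_thirring_ge1 Uu Vu Tu _ _ mu0 q1 sw) _.
- by move=> i; exact: powR_gt0.
- by move=> k; exact: powR_gt0.
have sw' : spec_mx U (fun i => s i `^ ((1 - p^-1) / 2)) *m spec_mx V a *m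
    spec_mx U (fun i => s i `^ ((1 - p^-1) / 2)) = spec_mx T' nu.
  rewrite -XE -AE -(GamE _ Uu) (GamD Uu s_gt0) invr1.
  by have -> : 1 - p^-1 + p^-1 = 1 by rewrite subrK.
have := mxtrace_spec_sandwich (fun i => s i `^ ((1 - p^-1) / 2)) a Uu Vu.
rewrite sw' (spec_mx_tr _ Tu') => /(@complexI R) trE.
under [leRHS]eq_bigr => k _ do rewrite powRr1 ?ltW //.
rewrite trE le_eqVlt; apply/orP; left; apply/eqP.
apply: eq_bigr => k _; apply: eq_bigr => i _; congr (_ * _).
rewrite -powRrM (_ : p / 2 * (2 / p) = 1); last by field.
rewrite powRr1 ?ltW //; congr (_ * _).
have sqE (x e : R) : (x `^ e) ^+ 2 = x `^ (e * 2).
  by rewrite powRrM powR_mulrn ?powR_ge0.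
rewrite !sqE -powRrM; congr (_ `^ _).
by field.
Qed.

End WeightedNorms.

(** (conj_exp p / 2) (2 - 2 / p) = 1, so multiplication by conj_exp p / 2 turns
    the dual inequality into the direct one, with half the constant. *)
Lemma dual_beckner_rescale (R : realType) (beta p N2 Np Nq N1 : R) (D : R[i]%C) :
  0 < beta -> 1 < p -> N2 = Np -> Nq <= N1 ->
  (beta * (N2 - Nq))%:C%C <= (2 - 2 / p)%:C%C * D ->
  (beta / 2 * conj_exp p * (Np - N1))%:C%C <= D.
Proof.
move=> beta0 p1 <- N1q dual.
have p_gt0 : 0 < p by apply: lt_trans p1.
have p10 : 0 < p - 1 by rewrite subr_gt0.
have c_gt0 : 0 < conj_exp p by rewrite divr_gt0.
have -> : D = (conj_exp p / 2)%:C%C * ((2 - 2 / p)%:C%C * D).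
  rewrite mulrA -(rmorphM (real_complex R)) (_ : conj_exp p / 2 * (2 - 2 / p) = 1) ?mul1r //.
  by rewrite /conj_exp; field; rewrite !gt_eqF.
apply: le_trans (_ : _ <= (conj_exp p / 2)%:C%C * (beta * (N2 - Nq))%:C%C) _; last first.
  by apply: ler_wpM2l => //; rewrite ler0c divr_ge0 ?ltW.
rewrite -(rmorphM (real_complex R)) lecR.
have -> : conj_exp p / 2 * (beta * (N2 - Nq)) = beta / 2 * conj_exp p * (N2 - Nq) by field.
apply: ler_wpM2l; last exact: lerB.
by apply: mulr_ge0 (ltW c_gt0); rewrite divr_ge0 ?(ltW beta0).
Qed.

Unset Implicit Arguments.

Theorem proposition3p14 (R : realType) (n : nat)
    (P : R -> {linear 'M[R[i]%C]_n -> 'M[R[i]%C]_n})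
    (L : {linear 'M[R[i]%C]_n -> 'M[R[i]%C]_n})
    (sigma : 'M[R[i]%C]_n) (p q beta : R) :
  QMS P -> is_generator P L ->
  primitive_with P sigma -> GNS_detailed_balance sigma L ->
  1 < p -> p <= 2 -> q = 2 / p ->
  dual_Beckner q sigma L beta ->
  exists alpha : R, beta / 2 <= alpha /\ Beckner p sigma L alpha.
Proof.
move=> qmsP genL [[[psd_sigma _] _] _ rk_sigma] gns p1 p2 -> [beta0 dual].
have sigma_unit : sigma \in unitmx by rewrite -row_free_unit /row_free rk_sigma.
have [U [s [Uu s_gt0 sigmaE]]] := psdmx_unit_spec psd_sigma sigma_unit.
move: gns dual; rewrite {}sigmaE => gns dual.
exists (beta / 2); split => //; split; first by rewrite divr_gt0.
move=> X pdX; have p12 : 1 < p <= 2 by rewrite p1.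
have [V [a [Vu a_gt0 AE]]] := pdmx_spec (Gam_pd Uu s_gt0 p^-1 pdX).
apply: le_trans (stroock_varopoulos Uu Vu s_gt0 a_gt0 qmsP genL gns p12 AE).
apply: (dual_beckner_rescale beta0 p1 (wnorm2_power Uu Vu s_gt0 a_gt0 p12 AE)
  (wnormq_power Uu Vu s_gt0 a_gt0 p12 AE pdX)); apply: dual.
by apply: (Gam_psd _ Uu); apply: spec_mx_psd => k; exact: powR_ge0.
Qed.
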